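(* Let $\mu$ be a finite positive Borel measure on $[0,1)$. Then the generalized Hilbert operator $\mathcal{H}_\mu$ is bounded from $H^\infty$ to $\Lambda^{1,\ast}_{1}$ if and only if $\mu$ is a Carleson measure.
   Context: Let $\mathbb{D}=\{z\in\mathbb{C}:|z|<1\}$ and let $H(\mathbb{D})$ be the space of all analytic functions on $\mathbb{D}$. $H^\infty$ is the space of $f\in H(\mathbb{D})$ with $\|f\|_\infty=\sup_{z\in\mathbb{D}}|f(z)|<\infty$. For $0\le r<1$ and $f\in H(\mathbb{D})$, $M_1(r,f)=\frac{1}{2\pi}\int_0^{2\pi}|f(re^{i\theta})|\,d\theta$. The Zygmund-type space $\Lambda^{1,\ast}_{1}$ consists of all $f\in H(\mathbb{D})$ with $$\|f\|_{\Lambda^{1,\ast}_{1}}=|f(0)|+|f'(0)|+\sup_{0<r<1}(1-r^2)M_1(r,f'')<\infty.$$ For a finite positive Borel measure $\mu$ on $[0,1)$ and an integer $n\ge 0$, put $\mu_n=\int_{[0,1)}t^n\,d\mu(t)$. For $f(z)=\sum_{n=0}^\infty a_nz^n\in H(\mathbb{D})$, the generalized Hilbert operator is $$\mathcal{H}_\mu(f)(z)=\sum_{n=0}^\infty\left(\sum_{k=0}^\infty\mu_{n+k}a_k\right)z^n,\quad z\in\mathbb{D},$$ whenever the right-hand side makes sense and defines an analytic function in $\mathbb{D}$. A positive Borel measure $\mu$ on $[0,1)$ is a Carleson measure (i.e. a $1$-Carleson measure) if there is a constant $C>0$ such that $\mu([t,1))\le C(1-t)$ for all $0\le t<1$. 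*)

(* Defs.v *)
From mathcomp Require Import all_boot all_order all_algebra.
From mathcomp Require Import all_classical all_reals all_analysis.
From mathcomp Require Export complex.

Set Implicit Arguments.
Unset Strict Implicit.
Unset Printing Implicit Defensive.

Import Order.TTheory GRing.Theory Num.Theory numFieldNormedType.Exports.

Local Open Scope classical_set_scope.
Local Open Scope ring_scope.
Local Open Scope complex_scope.

(* The topology and derivative on the complex field are those carried by the
   regular module [R[i]^o], i.e. R[i] as a normed space over itself. *)
Notation cplx R := (R[i]%C^o)%type.

Section AnalyticFunctions.
Context {R : realType}.
Implicit Types (f : cplx R -> cplx R) (a : nat -> cplx R) (z : cplx R).

Definition unit_disc : set (cplx R) := [set z | Normc.normc z < 1].

(* Functions are total: only their restriction to the disc is relevant below. *)
Definition analytic_on_disc f : Prop :=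
  forall z, unit_disc z -> derivable f z 1.

Definition power_series_on_disc f a : Prop :=
  forall z, unit_disc z -> series (fun n => a n * z ^+ n) @ \oo --> f z.

Definition Hinf_norm f : \bar R :=
  ereal_sup [set (Normc.normc (f z))%:E | z in unit_disc].

Definition in_Hinf f : Prop :=
  analytic_on_disc f /\ (Hinf_norm f < +oo)%E.

Definition M1 (r : R) f : \bar R :=
  (((2 * pi)^-1)%:E *
   \int[lebesgue_measure]_(t in `[0%R, (2 * pi)%R])
      (Normc.normc (f (r%:C * (cos t +i* sin t))))%:E)%E.

Definition zygmund_norm f : \bar R :=
  ((Normc.normc (f 0))%:E + (Normc.normc (derive1 f 0))%:E +
   ereal_sup [set (1 - r ^+ 2)%:E * M1 r (derive1n 2 f) | r in `]0%R, 1%R[])%E.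

Definition in_zygmund f : Prop :=
  analytic_on_disc f /\ (zygmund_norm f < +oo)%E.

End AnalyticFunctions.

Section GeneralizedHilbert.
Context {R : realType}.
Variable mu : {finite_measure set R -> \bar R}.
Implicit Types (a : nat -> cplx R) (z : cplx R).

Definition moment (n : nat) : R := \int[mu]_(t in `[0, 1[) t ^+ n.

Definition hilbert_coef_series a n : nat -> cplx R :=
  series (fun k => (moment (n + k))%:C * a k).

Definition hilbert_coef a n : cplx R := limn (hilbert_coef_series a n).

Definition hilbert_series a z : nat -> cplx R :=
  series (fun n => hilbert_coef a n * z ^+ n).

Definition hilbert a z : cplx R := limn (hilbert_series a z).

Definition hilbert_defined a : Prop :=
  [/\ forall n, cvgn (hilbert_coef_series a n),
      forall z, unit_disc z -> cvgn (hilbert_series a z)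
    & analytic_on_disc (hilbert a)].

(* [hilbert] is a function of the coefficients [a] of [f]; every analytic [f]
   on the disc has exactly one such [a], so quantifying over the pairs [(f, a)]
   with [power_series_on_disc f a] is quantifying over [f]. *)
Definition hilbert_bounded_Hinf_zygmund : Prop :=
  exists C : R, forall f a, in_Hinf f -> power_series_on_disc f a ->
    [/\ hilbert_defined a, in_zygmund (hilbert a)
      & (zygmund_norm (hilbert a) <= C%:E * Hinf_norm f)%E].

Definition carleson : Prop :=
  exists2 C : R, 0 < C &
    forall t : R, 0 <= t < 1 -> (mu `[t, 1%R[%classic <= (C * (1 - t))%:E)%E.

End GeneralizedHilbert.

(* Main.v *)
Require Import Defs.
From mathcomp Require Import all_boot all_order all_algebra.
From mathcomp Require Import all_classical all_reals all_analysis.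
From mathcomp Require Import measurable_realfun ring lra zify.

(** Write [F] for the transform of [f] and [c n] for its coefficients. Formally
    [c n = \int t ^ n f t dmu t], so
    [F'' z = \int 2 t ^ 2 f t / (1 - t z) ^ 3 dmu t].

    Sufficiency. On the circle of radius [r], [|1 - t z|] is at least [1 - r t], and
    [|1 - t z| ^ -2] is, up to the factor [1 - (r t) ^ 2], the Poisson kernel, of mean
    [1]; so Tonelli's theorem ([integral_cubic_kernel_le]) bounds [M1 r F''] by
    [2 sup |f|] times the integral of [(1 - r t) ^ -2] against [mu]. For a Carleson
    measure this integral is [O (1 / (1 - r))], by a dyadic decomposition of [[0, 1[]
    ([carleson_kernel_le]), and the factor [1 - r ^ 2] of the norm compensates it.

    The integral representation itself is never formed. It is replaced by the
    inequality [normc_sum_hilbert_coef_le]: a finite combination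
    [\sum x i * c (e i)] is at most [sup |f|] times the integral of the modulus of
    the polynomial [\sum x i * t ^ e i]. This is applied to the partial sums of
    [F''], whose polynomials are truncations of [2 t ^ 2 / (1 - t z) ^ 3] and have a
    closed form ([sum_second_diff]). For the series defining [c n] to converge one
    uses that a bounded function has square summable coefficients, by Parseval, and
    that the moments of a Carleson measure are [O (1 / n)] ([carleson_moment_le]).

    Necessity. The constant function [1] is transformed into the power series whose
    coefficients are the moments. A coefficient of [F''] is at most the mean of
    [|F''|] on a circle ([cauchy_estimate]), so boundedness says that
    [(1 - r ^ 2) (n + 1) (n + 2) mu_(n + 2) r ^ n] is bounded. As the moment
    [mu_(n + 2)] is at least [t ^ (n + 2) mu [t, 1[], taking [r = t] and [n] of order
    [1 / (1 - t)] gives the Carleson condition. *)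

Set Implicit Arguments.
Unset Strict Implicit.
Unset Printing Implicit Defensive.

Import Order.TTheory GRing.Theory Num.Theory numFieldNormedType.Exports.

Local Open Scope classical_set_scope.
Local Open Scope ring_scope.

(** * The modulus and convergence in the complex field *)

Section ComplexModulus.
Context {R : realType}.
Implicit Types (z w : cplx R) (u : nat -> cplx R).
Local Notation normc := (@Normc.normc R).

Lemma normc_norm z : `|z| = (normc z)%:C%C.
Proof. by []. Qed.

(* The properties of the modulus are restated at the regular module [cplx R], the
   type at which the topology lives. *)
Lemma normc_ge0 z : 0 <= normc z.
Proof. by case: z => a b; exact: sqrtr_ge0. Qed.

Lemma normc0 : normc (0 : cplx R) = 0.
Proof. exact: Normc.normc0. Qed.

Lemma normcM z w : normc (z * w) = normc z * normc w.
Proof. exact: Normc.normcM. Qed.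

Lemma normc1 : normc (1 : cplx R) = 1.
Proof. exact: Normc.normc1. Qed.

Lemma normcX z n : normc (z ^+ n) = normc z ^+ n.
Proof. by elim: n => [|n IH]; rewrite ?expr0 ?normc1// !exprS normcM IH. Qed.

Lemma ler_normcD z w : normc (z + w) <= normc z + normc w.
Proof. exact: le_normcD. Qed.

Lemma normcN z : normc (- z) = normc z.
Proof. exact: normcN. Qed.

Lemma normcV z : normc (z^-1) = (normc z)^-1.
Proof. exact: Normc.normcV. Qed.

Lemma normcB z w : normc (z - w) = normc (w - z).
Proof. by rewrite -normcN opprB. Qed.

Lemma ler_normcB z w : normc (z - w) <= normc z + normc w.
Proof. by rewrite (le_trans (ler_normcD _ _))// normcN. Qed.

Lemma ler_dist_normc z w : normc z - normc w <= normc (z - w).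
Proof.
by rewrite lerBlDr -{1}(subrK w z) ler_normcD.
Qed.

Lemma ler_normc_sum I (r : seq I) (P : pred I) (F : I -> cplx R) :
  normc (\sum_(i <- r | P i) F i) <= \sum_(i <- r | P i) normc (F i).
Proof.
elim/big_ind2 : _ => [|x a y b xa yb|//]; first by rewrite normc0.
by rewrite (le_trans (ler_normcD _ _))// lerD.
Qed.

Lemma normc_real (x : R) : normc (x%:C%C : cplx R) = `|x|.
Proof. by rewrite /Normc.normc/= expr0n/= addr0 sqrtr_sqr. Qed.

Lemma normc_nat n : normc (n%:R : cplx R) = n%:R.
Proof.
have -> : (n%:R : cplx R) = (n%:R%:C)%C by rewrite rmorph_nat.
by rewrite normc_real ger0_norm.
Qed.

Lemma ReD z w : complex.Re (z + w) = complex.Re z + complex.Re w.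
Proof. by case: z => a b; case: w. Qed.

Lemma ReB z w : complex.Re (z - w) = complex.Re z - complex.Re w.
Proof. by case: z => a b; case: w. Qed.

Lemma Re_sum I (r : seq I) (P : pred I) (F : I -> cplx R) :
  complex.Re (\sum_(i <- r | P i) F i) = \sum_(i <- r | P i) complex.Re (F i).
Proof. by elim/big_ind2 : _ => // x a y b <- <-; rewrite ReD. Qed.

Lemma Re_mul_real z (x : R) : complex.Re (z * (x%:C)%C) = complex.Re z * x.
Proof. by case: z => a b; rewrite /= mulr0 subr0. Qed.

Lemma normr_Re_le z : `|complex.Re z| <= normc z.
Proof.
case: z => a b /=; rewrite -sqrtr_sqr ler_wsqrtr// lerDl sqr_ge0//.
Qed.

Lemma normr_Im_le z : `|complex.Im z| <= normc z.
Proof.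
case: z => a b /=; rewrite -sqrtr_sqr ler_wsqrtr// lerDr sqr_ge0//.
Qed.

Lemma Re_le_normc z : complex.Re z <= normc z.
Proof. exact: le_trans (ler_norm _) (normr_Re_le _). Qed.

Lemma normc_le_ReIm z : normc z <= `|complex.Re z| + `|complex.Im z|.
Proof.
case: z => a b /=; rewrite -[leRHS]ger0_norm ?addr_ge0// -sqrtr_sqr ler_wsqrtr//.
rewrite sqrrD !real_normK ?num_real// -addrA lerD2l lerDr.
by rewrite mulrn_wge0// mulr_ge0.
Qed.

Lemma normc_sqrE z : normc z ^+ 2 = complex.Re (z * (z^*)%C).
Proof.
case: z => a b /=; rewrite sqr_sqrtr ?addr_ge0 ?sqr_ge0//.
by rewrite -!expr2 mulrN opprK.
Qed.

(** Multiplying by a unimodular number turns the modulus into a real part;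
    this is how inequalities between complex integrals are reduced to real
    ones. *)
Lemma exists_phase z : exists2 w : cplx R, normc w = 1 &
  complex.Re (w * z) = normc z.
Proof.
have [->|z0] := eqVneq z 0.
  by exists 1; rewrite ?normc1// mulr0 normc0.
have nz0 : normc z != 0 by apply: contra_neq z0 => /Normc.eq0_normc.
have nJ : normc (z^*)%C = normc z by case: (z) => a b /=; rewrite sqrrN.
exists ((z^*)%C * ((normc z)^-1)%:C%C).
  by rewrite normcM nJ normc_real ger0_norm ?invr_ge0 ?normc_ge0// divff.
by rewrite mulrAC Re_mul_real mulrC [X in complex.Re X]mulrC -normc_sqrE expr2 mulKf.
Qed.

(** Convergence in the complex field is convergence to [0] of a real sequence,
    since a positive complex number is a positive real. *)
Lemma cvg_normcP (T : Type) (F : set_system T) {FF : Filter F}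
    (u : T -> cplx R) (l : cplx R) :
  u @ F --> l <-> (fun n => normc (u n - l)) @ F --> (0 : R).
Proof.
split.
- move=> ul; apply/cvgr0Pnorm_lt => e e0.
  move/cvgrPdist_lt : ul => /(_ (e%:C)%C); rewrite ltcR => /(_ e0).
  apply: filterS => n; rewrite normc_norm ltcR normcB.
  by rewrite ger0_norm ?normc_ge0.
- move=> ul; apply/cvgrPdist_lt => e e0.
  have eE : e = (complex.Re e)%:C%C.
    by move: e0; rewrite ltcE => /andP[/eqP/= Ie _]; case: e Ie => a b /= ->.
  move: e0; rewrite eE ltcR => e0.
  move/cvgr0Pnorm_lt : ul => /(_ _ e0).
  apply: filterS => n; rewrite ger0_norm ?normc_ge0//.
  by rewrite normc_norm ltcR normcB.
Qed.

Lemma cvg_normc_le (T : Type) (F : set_system T) {FF : Filter F}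
    (u : T -> cplx R) (l : cplx R) (e : T -> R) :
  (\forall n \near F, normc (u n - l) <= e n) -> e @ F --> (0 : R) -> u @ F --> l.
Proof.
move=> ue e0; apply/cvg_normcP.
apply: (@squeeze_cvgr _ _ _ _ (fun=> 0) e) => //; last exact: cvg_cst.
by apply: filterS ue => n ->; rewrite normc_ge0.
Qed.

Lemma cvg_normc (T : Type) (F : set_system T) {FF : Filter F}
    (u : T -> cplx R) (l : cplx R) :
  u @ F --> l -> (fun n => normc (u n)) @ F --> normc l.
Proof.
move=> /cvg_normcP /cvgr0Pnorm_lt ul; apply/cvgrPdist_lt => e e0.
apply: filterS (ul _ e0) => n; rewrite ger0_norm ?normc_ge0// => h.
apply: le_lt_trans h; rewrite ler_norml lerNl opprB ler_dist_normc/=.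
by rewrite normcB ler_dist_normc.
Qed.

Lemma normc_cvg_le u (l : cplx R) (B : R) : u @ \oo --> l ->
  (\forall n \near \oo, normc (u n) <= B) -> normc l <= B.
Proof.
move=> /cvg_normc ul uB.
rewrite -(cvg_lim _ ul)//; apply: limr_le => //.
by apply/cvg_ex; exists (normc l).
Qed.

(** The completeness of the complex field, in the only form needed: absolute
    convergence, obtained from that of the real and imaginary parts. *)
Lemma cvg_series_normc (u : nat -> cplx R) :
  cvgn (series (fun n => normc (u n))) -> cvgn (series u).
Proof.
move=> cu.
have cvg_dist_lim (v : R^nat) : cvgn v ->
    (fun n => `|v n - limn v|) @ \oo --> (0 : R).
  move=> cv; have := cvg_norm (cvgB cv (cvg_cst (limn v))).
  by rewrite subrr normr0; apply.
have cRe : cvgn (series (fun n => complex.Re (u n))).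
  apply: normed_cvg; apply: series_le_cvg cu => n //=; first exact: normc_ge0.
  exact: normr_Re_le.
have cIm : cvgn (series (fun n => complex.Im (u n))).
  apply: normed_cvg; apply: series_le_cvg cu => n //=; first exact: normc_ge0.
  exact: normr_Im_le.
apply/cvg_ex; exists ((limn (series (fun n => complex.Re (u n))))
   +i* (limn (series (fun n => complex.Im (u n)))))%C.
apply: (@cvg_normc_le _ _ _ _ _ (fun n =>
  `|series (fun n => complex.Re (u n)) n - limn (series (fun n => complex.Re (u n)))|
  + `|series (fun n => complex.Im (u n)) n - limn (series (fun n => complex.Im (u n)))|)).
  apply: nearW => n; apply: le_trans (normc_le_ReIm _) _.
  rewrite /series/=.
  have -> : \sum_(0 <= k < n) u k = ((\sum_(0 <= k < n) complex.Re (u k)) +i*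
       (\sum_(0 <= k < n) complex.Im (u k)))%C.
    elim: n => [|n IH]; first by rewrite !big_nil.
    by rewrite !big_nat_recr//= IH; case: (u n).
  by [].
rewrite -[X in _ --> X](addr0 (0 : R)); apply: cvgD.
  exact: cvg_dist_lim.
exact: cvg_dist_lim.
Qed.

Lemma cvg_series_bounded (u : nat -> cplx R) (K : R) :
  (forall N, \sum_(0 <= n < N) normc (u n) <= K) -> cvgn (series u).
Proof.
move=> uK; apply: cvg_series_normc; apply: nondecreasing_is_cvgn.
  by apply: nondecreasing_series => n _ _; exact: normc_ge0.
by exists K => _ [N _ <-]; exact: uK.
Qed.

End ComplexModulus.

(** * Power series in the unit disc *)

Section PowerSeries.
Context {R : realType}.
Implicit Types (c : nat -> cplx R) (z w h : cplx R).
Local Notation normc := (@Normc.normc R).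

(** The coefficient sequences of the power series that converge in the unit
    disc, in Abel's form. *)
Definition disc_coef c : Prop :=
  forall rho : R, 0 < rho < 1 -> exists M, forall n, normc (c n) * rho ^+ n <= M.

Definition psum c z : cplx R := limn (series (fun n => c n * z ^+ n)).

Definition dcoef c n : cplx R := n.+1%:R * c n.+1.

(** This truncated form of [2 / (1 - w) ^ 3 = \sum (n + 1) (n + 2) w ^ n]
    bounds the sums over [n], and gives the kernel of the second derivative
    without differentiating a geometric series. *)
Lemma sum_second_diff (A : comNzRingType) (w : A) N :
  (1 - w) ^+ 3 * \sum_(0 <= n < N) (n.+1 * n.+2)%:R * w ^+ n =
  2 - w ^+ N * ((N.+1 * N.+2)%:R - (2 * N * N.+2)%:R * w + (N * N.+1)%:R * w ^+ 2).
Proof.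
elim: N => [|N IH].
  by rewrite big_nil mulr0 expr0 !muln0 !mul0n !mul0r subr0 addr0 mul1r subrr.
rewrite big_nat_recr//= mulrDr IH !natrM [w ^+ N.+1]exprSr.
rewrite -[N.+3%:R]natr1 -[N.+2%:R]natr1 -[N.+1%:R]natr1.
move: (N%:R) (w ^+ N) => n x; ring.
Qed.

Lemma sum_second_diff_le (x : R) N : 0 <= x < 1 ->
  \sum_(0 <= n < N) (n.+1 * n.+2)%:R * x ^+ n <= 2 / (1 - x) ^+ 3.
Proof.
move=> /andP[x0 x1].
rewrite ler_pdivlMr ?exprn_gt0 ?subr_gt0// mulrC sum_second_diff.
rewrite gerBl mulr_ge0 ?exprn_ge0// !natrM -[N.+2%:R]natr1 -[N.+1%:R]natr1.
have : (0 : R) <= N%:R by rewrite ler0n.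
move: (N%:R : R) => n n0.
rewrite (_ : _ + _ = 2 + 2 * n * (1 - x) + n * (n + 1) * (1 - x) ^+ 2); last ring.
by rewrite !addr_ge0 ?mulr_ge0 ?sqr_ge0 ?subr_ge0 ?(ltW x1)// addr_ge0.
Qed.

Let mid (x : R) : 0 <= x -> x < 1 -> exists y : R, [/\ x < y, 0 < y & y < 1].
Proof. by move=> x0 x1; exists ((1 + x) / 2); split; lra. Qed.

(** Comparing the radius [rho] with a larger one turns boundedness of the terms
    into geometric decay. *)
Lemma disc_coef_geometric c (rho : R) : disc_coef c -> 0 <= rho < 1 ->
  exists M x, [/\ 0 <= M, 0 <= x < 1 &
    forall n, normc (c n) * rho ^+ n <= M * x ^+ n].
Proof.
move=> tc /andP[r0 r1]; have [s [rs s0 s1]] := mid r0 r1.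
have [M cM] := tc s (introT andP (conj s0 s1)).
exists M, (rho / s); split.
- by rewrite (le_trans _ (cM 0%N))// mulr_ge0// ?normc_ge0// exprn_ge0 ?ltW.
- by rewrite divr_ge0 ?(ltW s0)//= ltr_pdivrMr// mul1r.
move=> n; rewrite expr_div_n mulrA ler_pdivlMr ?exprn_gt0// mulrAC.
by rewrite ler_wpM2r ?exprn_ge0.
Qed.

Lemma disc_coef_sum_second_diff c (rho : R) : disc_coef c -> 0 <= rho < 1 ->
  exists K, forall N,
    \sum_(0 <= n < N) (n.+1 * n.+2)%:R * (normc (c n) * rho ^+ n) <= K.
Proof.
move=> tc r01; have [M [x [M0 x01 cM]]] := disc_coef_geometric tc r01.
exists (M * (2 / (1 - x) ^+ 3)) => N.
apply: le_trans (ler_wpM2l M0 (sum_second_diff_le N x01)).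
rewrite mulr_sumr; apply: ler_sum_nat => n _.
by rewrite [leRHS]mulrCA ler_wpM2l// ler0n.
Qed.

Lemma disc_coef_sum c (rho : R) : disc_coef c -> 0 <= rho < 1 ->
  exists K, forall N, \sum_(0 <= n < N) normc (c n) * rho ^+ n <= K.
Proof.
move=> tc r01; have [K cK] := disc_coef_sum_second_diff tc r01.
exists K => N; apply: le_trans (cK N); apply: ler_sum_nat => n _.
rewrite ler_peMl ?mulr_ge0 ?normc_ge0 ?exprn_ge0//; first by case/andP: r01.
by rewrite ler1n muln_gt0.
Qed.

Lemma disc_coef_dcoef c : disc_coef c -> disc_coef (dcoef c).
Proof.
move=> tc rho /andP[r0 r1].
have [K cK] := disc_coef_sum_second_diff tc (introT andP (conj (ltW r0) r1)).
exists (K / rho) => n; rewrite ler_pdivlMr//.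
apply: le_trans (cK n.+2); rewrite big_nat_recr//= ler_wpDl//.
  apply: sumr_ge0 => i _; rewrite !mulr_ge0 ?ler0n ?normc_ge0// exprn_ge0//.
  exact: ltW.
rewrite /dcoef normcM normc_nat -!mulrA -exprSr.
rewrite ler_wpM2r ?mulr_ge0 ?normc_ge0 ?exprn_ge0 ?(ltW r0)//.
by rewrite ler_nat (leq_trans (leqnSn _))// leq_pmulr.
Qed.

Lemma cvg_psum c z : disc_coef c -> normc z < 1 ->
  series (fun n => c n * z ^+ n) @ \oo --> psum c z.
Proof.
move=> tc z1.
have [K cK] := disc_coef_sum tc (introT andP (conj (normc_ge0 z) z1)).
apply: (@cvg_series_bounded _ _ K) => N.
by under eq_bigr do rewrite normcM normcX.
Qed.

(** Uniform convergence on smaller closed discs, with a rate that does not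
    depend on the point. *)
Lemma psum_tail c (rho : R) : disc_coef c -> 0 <= rho < 1 ->
  exists2 e : nat -> R, e @ \oo --> (0 : R) &
    forall z N, normc z <= rho ->
      normc (psum c z - series (fun n => c n * z ^+ n) N) <= e N.
Proof.
move=> tc r01; have [M [x [M0 /andP[x0 x1] cM]]] := disc_coef_geometric tc r01.
exists (fun N => M / (1 - x) * x ^+ N).
  rewrite -(mulr0 (M / (1 - x))); apply: cvgMr.
  by apply: cvg_expr; rewrite ger0_norm.
move=> z N zr; have z1 : normc z < 1 by case/andP: r01 => _; exact: le_lt_trans.
have cz := cvg_psum tc z1.
have cz' : (fun P => series (fun n => c n * z ^+ n) P -
    series (fun n => c n * z ^+ n) N) @ \oo -->
    psum c z - series (fun n => c n * z ^+ n) N.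
  exact: cvgB cz (cvg_cst _).
apply: (normc_cvg_le cz'); near=> P.
have NP : (N <= P)%N by near: P; exact: nbhs_infty_ge.
rewrite /series/= (big_cat_nat (leq0n N) NP)//= addrAC subrr add0r.
apply: le_trans (ler_normc_sum _ _ _) _.
apply: (@le_trans _ _ (\sum_(N <= n < P) M * x ^+ n)).
  apply: ler_sum_nat => n _; rewrite normcM normcX.
  apply: le_trans (cM n); rewrite ler_wpM2l ?normc_ge0//.
  by rewrite lerXn2r ?nnegrE ?normc_ge0//; case/andP: r01.
rewrite -mulr_sumr -mulrA ler_wpM2l//.
rewrite mulrC ler_pdivlMr ?subr_gt0//.
have -> : (\sum_(N <= n < P) x ^+ n) * (1 - x) = x ^+ N - x ^+ P.
  rewrite -(subnK NP); elim: (P - N)%N => [|k IH].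
    by rewrite add0n big_geq// mul0r subrr.
  by rewrite addSn big_nat_recr ?leq_addl//= mulrDl IH exprS; ring.
by rewrite gerBl exprn_ge0.
Unshelve. all: by end_near. Qed.

(** The second order Taylor remainder [D n] of [z ^+ n] satisfies
    [D n.+1 = (z + h) * D n + n * h ^ 2 * z ^ n.-1], whence a bound that is
    quadratic in [n]; multiplying by [rho ^+ 2] avoids the exponent [n - 2]. *)
Lemma taylor_expr z h (rho : R) n : normc z <= rho -> normc (z + h) <= rho ->
  normc ((z + h) ^+ n - z ^+ n - n%:R * h * z ^+ n.-1) * rho ^+ 2
    <= (n * n)%:R * normc h ^+ 2 * rho ^+ n.
Proof.
move=> zr zhr; have r0 : 0 <= rho by exact: le_trans (normc_ge0 _) zr.
elim: n => [|n IH].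
  by rewrite !expr0 subrr !mul0r subr0 normc0 mul0r.
have -> : (z + h) ^+ n.+1 - z ^+ n.+1 - n.+1%:R * h * z ^+ n.+1.-1 =
    (z + h) * ((z + h) ^+ n - z ^+ n - n%:R * h * z ^+ n.-1)
    + n%:R * h ^+ 2 * z ^+ n.-1.
  case: n {IH} => [|n]; first by rewrite !expr0 !expr1 /=; ring.
  by rewrite -!natr1 /= !exprS; ring.
apply: (@le_trans _ _ (rho * ((n * n)%:R * normc h ^+ 2 * rho ^+ n)
    + n%:R * normc h ^+ 2 * rho ^+ n.+1)).
  apply: le_trans (ler_wpM2r _ (ler_normcD _ _)) _; rewrite ?exprn_ge0//.
  rewrite mulrDl; apply: lerD.
    by rewrite normcM -[leLHS]mulrA ler_pM ?mulr_ge0 ?normc_ge0 ?exprn_ge0.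
  case: n {IH} => [|n] /=; first by rewrite !mul0r normc0 mul0r.
  rewrite !normcM normc_nat !normcX -!mulrA ler_wpM2l// ler_wpM2l ?normc_ge0//.
  rewrite -[n.+2]addn2 exprD ler_wpM2l ?normc_ge0// ler_wpM2r ?exprn_ge0//.
  by rewrite lerXn2r ?nnegrE ?normc_ge0.
rewrite [rho ^+ n.+1]exprS (_ : _ + _ = (n * n + n)%:R * normc h ^+ 2 * (rho * rho ^+ n)).
  rewrite ler_wpM2r ?mulr_ge0 ?exprn_ge0// ler_wpM2r ?exprn_ge0 ?normc_ge0//.
  by rewrite ler_nat; nia.
by rewrite natrD; ring.
Qed.

(** Summing the Taylor remainders of the monomials: the error is quadratic in [h],
    which gives differentiability term by term. *)
Lemma psum_diff_quotient c z (rho : R) : disc_coef c -> normc z < rho -> rho < 1 ->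
  exists K : R, forall h, normc (z + h) <= rho ->
    normc (psum c (z + h) - psum c z - h * psum (dcoef c) z) <= K * normc h ^+ 2.
Proof.
move=> tc zr r1.
have r0 : 0 < rho by exact: le_lt_trans (normc_ge0 _) zr.
have [K cK] := disc_coef_sum_second_diff tc (introT andP (conj (ltW r0) r1)).
exists (K / rho ^+ 2) => h zhr.
have z1 := lt_trans zr r1; have zh1 := le_lt_trans zhr r1.
(* The derived series is truncated one term earlier, to match degrees. *)
pose S n := series (fun n => c n * (z + h) ^+ n) n.+1 -
  series (fun n => c n * z ^+ n) n.+1 - h * series (fun n => dcoef c n * z ^+ n) n.
have cS : S @ \oo --> psum c (z + h) - psum c z - h * psum (dcoef c) z.
  apply: cvgB.
    apply: cvgB.
      by have := cvg_psum tc zh1; rewrite -cvg_shiftS; apply.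
    by have := cvg_psum tc z1; rewrite -cvg_shiftS; apply.
  by apply: cvgMr; apply: cvg_psum => //; exact: disc_coef_dcoef.
apply: (normc_cvg_le cS); apply: nearW => N.
have -> : S N = \sum_(0 <= n < N.+1)
    c n * ((z + h) ^+ n - z ^+ n - n%:R * h * z ^+ n.-1).
  rewrite /S /series/= -sumrB.
  rewrite mulr_sumr [X in _ - X](_ : _ =
      \sum_(0 <= n < N.+1) c n * (n%:R * h * z ^+ n.-1)).
    by rewrite -sumrB; apply: eq_bigr => n _; rewrite !mulrBr.
  rewrite big_nat_recl// !mul0r mulr0 add0r; apply: eq_bigr => n _.
  by rewrite /dcoef/=; ring.
rewrite mulrAC ler_pdivlMr ?exprn_gt0//.
apply: le_trans (ler_wpM2r _ (ler_normc_sum _ _ _)) _; rewrite ?sqr_ge0//.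
apply: le_trans (ler_wpM2r _ (cK N.+1)); rewrite ?sqr_ge0//.
rewrite !mulr_suml; apply: ler_sum_nat => n _; rewrite normcM -[leLHS]mulrA.
apply: le_trans (ler_wpM2l _ (taylor_expr n (ltW zr) zhr)) _; rewrite ?normc_ge0//.
rewrite [leLHS](_ : _ = (n * n)%:R * (normc (c n) * rho ^+ n) * normc h ^+ 2);
  last by ring.
rewrite ler_wpM2r ?sqr_ge0// ler_wpM2r ?mulr_ge0 ?normc_ge0 ?exprn_ge0 ?(ltW r0)//.
by rewrite ler_nat; nia.
Qed.

Lemma is_derive_psum c z : disc_coef c -> normc z < 1 ->
  is_derive z 1 (psum c : cplx R -> cplx R) (psum (dcoef c) z).
Proof.
move=> tc z1; have [rho [zr r0 r1]] := mid (normc_ge0 z) z1.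
have [K HK] := psum_diff_quotient tc zr r1.
have cD : (fun h : cplx R => (h : R[i]%C)^-1 *:
    ((psum c \o shift z) ((h : R[i]%C) *: (1 : cplx R)) - psum c z)) @ 0^'
    --> (psum (dcoef c) z : cplx R).
  have c0 : (fun h : cplx R => normc h) @ 0^' --> (0 : R).
    rewrite -[X in _ --> X](@normc0 R).
    apply: (@cvg_normc _ (cplx R) _ _ (fun h => h)); exact: nbhs_dnbhs.
  apply: (@cvg_normc_le _ _ _ _ _ _ (fun h => K * normc h)); last first.
    by rewrite -(mulr0 K); apply: cvgMr.
  near=> h.
  have h0 : h != 0 by near: h; exact: nbhs_dnbhs_neq.
  have hr : normc (z + h) <= rho.
    apply: le_trans (ler_normcD _ _) _; rewrite -lerBrDl ltW//.
    rewrite -[normc h]ger0_norm ?normc_ge0//.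
    by near: h; move/cvgr0Pnorm_lt : c0; apply; rewrite subr_gt0.
  have nh0 : 0 < normc h.
    rewrite lt_neqAle normc_ge0 andbT eq_sym; apply: contra_neq h0.
    exact: Normc.eq0_normc.
  rewrite -(ler_pM2l nh0) mulrCA -expr2 -normcM.
  apply: le_trans (HK h hr); rewrite le_eqVlt; apply/orP; left; apply/eqP.
  congr normc; rewrite /= mulrBr; congr (_ - _).
  have scE (a : R[i]%C) (w : cplx R) : a *: w = (a : cplx R) * w by [].
  by rewrite !scE mulr1 mulrA divff// mul1r [h + z]addrC.
apply: DeriveDef; first by apply/cvg_ex; exists (psum (dcoef c) z).
exact: cvg_lim cD.
Unshelve. all: by end_near. Qed.

End PowerSeries.

(** * Integrals of trigonometric polynomials *)

Section CircleMeans.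
Context {R : realType}.
Implicit Types (c : nat -> cplx R) (x z w : cplx R) (t rho : R).
Local Notation normc := (@Normc.normc R).
Local Notation leb := (@lebesgue_measure R).

Definition cis t : cplx R := (cos t +i* sin t)%C.

Lemma cisD s t : cis (s + t) = cis s * cis t.
Proof. by rewrite /cis cosD sinD/=; apply/eqP; rewrite eq_complex/= eqxx/= addrC. Qed.

Lemma cisN t : cis (- t) = ((cis t)^*)%C.
Proof. by rewrite /cis cosN sinN. Qed.

Lemma cis0 : cis 0 = 1.
Proof. by rewrite /cis cos0 sin0. Qed.

Lemma cisX t n : cis t ^+ n = cis (n%:R * t).
Proof.
elim: n => [|n IH]; first by rewrite expr0 mul0r cis0.
by rewrite exprS IH -cisD -natr1; congr cis; ring.
Qed.

Lemma normc_cis t : normc (cis t) = 1.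
Proof. by rewrite /= cos2Dsin2 sqrtr1. Qed.

Lemma cis_2pi : cis (2 * pi) = 1.
Proof. by rewrite /cis mulr_natl cos2pi sin2pi. Qed.

Lemma continuous_Re_mul_cis x (a : R) :
  continuous (fun t => complex.Re (x * cis (a * t))).
Proof.
move=> t; case: x => p q /=.
apply: cvgB; apply: cvgM; (try exact: cvg_cst).
  by apply: continuous_comp; [exact: mulrl_continuous|exact: continuous_cos].
by apply: continuous_comp; [exact: mulrl_continuous|exact: continuous_sin].
Qed.

Instance is_derive_Re_mul_cis x (a t : R) :
  is_derive t 1 (fun t => complex.Re (x * cis (a * t)))
    (complex.Re (x * (- sin (a * t) +i* cos (a * t))%C) * a).
Proof.
case: x => p q /=.
have da : is_derive t 1 (fun t => a * t) a.
  by apply: is_derive_eq; rewrite /GRing.scale/= mulr1.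
by apply: is_derive_eq; rewrite /GRing.scale/=; ring.
Qed.

Lemma circle_integrable (f : R -> R) : continuous f ->
  leb.-integrable `[0, 2 * pi] (EFin \o f).
Proof.
move=> cf; apply: continuous_compact_integrable; first exact: segment_compact.
exact: continuous_subspaceT.
Qed.

Lemma circle_integral_cst (r : R) :
  \int[leb]_(t in `[0, 2 * pi]) (cst r t) = 2 * pi * r.
Proof.
rewrite Rintegral_cst//= lebesgue_measure_itv/= lte_fin.
by rewrite mulr_gt0 ?pi_gt0//= subr0 mulrC.
Qed.

(** The integrand has a primitive of the same form, which takes the same value at
    both ends since [cis (a * t)] does. *)
Lemma circle_integral_cis x (a : R) : a != 0 -> cis (a * (2 * pi)) = 1 ->
  \int[leb]_(t in `[0, 2 * pi]) complex.Re (x * cis (a * t)) = 0.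
Proof.
move=> a0 a2pi; case: x => p q.
pose y : cplx R := (q / a +i* (- p / a))%C.
rewrite /Rintegral (@continuous_FTC2 _ _ (fun t => complex.Re (y * cis (a * t)))).
- by rewrite a2pi mulr0 cis0 subee.
- by rewrite mulr_gt0// pi_gt0.
- exact/continuous_subspaceT/continuous_Re_mul_cis.
- split=> [t _||]; first exact: ex_derive.
  + by apply: cvg_at_right_filter; exact: continuous_Re_mul_cis.
  + by apply: cvg_at_left_filter; exact: continuous_Re_mul_cis.
- move=> t _; rewrite derive1E derive_val /=; by field.
Qed.

Lemma cis_monomial t k l :
  cis t ^+ k * cis (- t) ^+ l = cis ((k%:R - l%:R) * t).
Proof. by rewrite !cisX -cisD; congr cis; ring. Qed.

Lemma circle_integral_monomial x k l :
  \int[leb]_(t in `[0, 2 * pi]) complex.Re (x * cis ((k%:R - l%:R) * t)) =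
  2 * pi * (if k == l then complex.Re x else 0).
Proof.
case: eqP => [->|/eqP kl].
  rewrite subrr -circle_integral_cst; apply: eq_Rintegral => t _ /=.
  by rewrite mul0r cis0 mulr1.
rewrite mulr0 circle_integral_cis ?subr_eq0 ?eqr_nat//.
by rewrite -cis_monomial cisN cis_2pi !(expr1n, mul1r)/= oppr0 expr1n.
Qed.

(** Orthogonality of the characters, for trigonometric polynomials written as
    sums of monomials in [cis t] and its conjugate [cis (- t)]. *)
Lemma circle_integral_trig I (r : seq I) (x : I -> cplx R) (k l : I -> nat) :
  let f t := complex.Re
    (\sum_(i <- r) x i * (cis t ^+ k i * cis (- t) ^+ l i)) in
  continuous f /\
  \int[leb]_(t in `[0, 2 * pi]) f t =
    2 * pi * \sum_(i <- r | k i == l i) complex.Re (x i).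
Proof.
elim: r => [|i r [IHc IH]] /=.
  under [X in continuous X]eq_fun do rewrite big_nil.
  under eq_Rintegral do rewrite big_nil.
  rewrite (circle_integral_cst 0) big_nil; split=> // t.
  exact: cvg_cst.
have E : (fun t => complex.Re
    (\sum_(j <- i :: r) x j * (cis t ^+ k j * cis (- t) ^+ l j))) =
    (fun t => complex.Re (x i * cis (((k i)%:R - (l i)%:R) * t)) +
     complex.Re (\sum_(j <- r) x j * (cis t ^+ k j * cis (- t) ^+ l j))).
  by apply/funext => t; rewrite big_cons ReD -cis_monomial.
rewrite E; split.
  move=> t; apply: cvgD; last exact: IHc.
  exact: continuous_Re_mul_cis.
rewrite RintegralD//; last 2 first.
- have cm := @continuous_Re_mul_cis (x i) ((k i)%:R - (l i)%:R).
  by have := circle_integrable cm; apply.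
- exact: circle_integrable IHc.
rewrite IH circle_integral_monomial big_cons; case: eqP => _; ring.
Qed.

Lemma continuous_cis : continuous cis.
Proof.
move=> t; apply: (@cvg_normc_le _ _ (nbhs t) _ cis (cis t)
  (fun s => `|cos s - cos t| + `|sin s - sin t|)).
  by apply: nearW => s; exact: normc_le_ReIm.
rewrite -[X in _ --> X](addr0 (0 : R)); apply: cvgD.
  rewrite -(normr0 R) -(subrr (cos t)); apply: cvg_norm.
  by apply: cvgB; [exact: continuous_cos|exact: cvg_cst].
rewrite -(normr0 R) -(subrr (sin t)); apply: cvg_norm.
by apply: cvgB; [exact: continuous_sin|exact: cvg_cst].
Qed.

Lemma normc_circle rho t : 0 <= rho -> normc ((rho%:C)%C * cis t) = rho.
Proof. by move=> r0; rewrite normcM normc_cis normc_real mulr1 ger0_norm. Qed.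

Lemma continuous_psum c z : disc_coef c -> normc z < 1 ->
  {for z, continuous (psum c : cplx R -> cplx R)}.
Proof.
move=> tc z1; apply: differentiable_continuous; apply/derivable1_diffP.
by have [] := is_derive_psum tc z1.
Qed.

Lemma continuous_psum_circle c rho : disc_coef c -> 0 <= rho < 1 ->
  continuous (fun t => psum c ((rho%:C)%C * cis t)).
Proof.
move=> tc /andP[r0 r1] t.
have cw : (fun t => (rho%:C)%C * cis t) @ t --> ((rho%:C)%C * cis t : cplx R).
  by apply: cvgMr; exact: continuous_cis.
have w1 : normc ((rho%:C)%C * cis t) < 1 by rewrite normc_circle.
exact: (cvg_comp _ _ cw (continuous_psum tc w1)).
Qed.

Lemma continuous_normc_comp (f : R -> cplx R) : continuous f ->
  continuous (fun t => normc (f t)).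
Proof. by move=> cf t; exact: cvg_normc (cf t). Qed.

Lemma continuous_Re_comp (f : R -> cplx R) : continuous f ->
  continuous (fun t => complex.Re (f t)).
Proof.
move=> cf t; apply/cvgrPdist_lt => e e0.
have /cvg_normcP/cvgr0Pnorm_lt/(_ _ e0) := cf t.
apply: filterS => s; rewrite ger0_norm ?normc_ge0//; apply: le_lt_trans.
rewrite distrC; apply: le_trans (normr_Re_le _).
by case: (f s) (f t) => a b [].
Qed.

End CircleMeans.

(** * Coefficients as circle means *)

Section CircleCoefficients.
Context {R : realType}.
Implicit Types (c : nat -> cplx R) (u z w : cplx R) (t rho : R).
Local Notation normc := (@Normc.normc R).
Local Notation leb := (@lebesgue_measure R).

Lemma continuous_mul_cisJ (f : R -> cplx R) u n : continuous f ->
  continuous (fun t => u * (f t * cis (- t) ^+ n)).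
Proof.
move=> cf t; apply: cvgMr; apply: cvgM; first exact: cf.
have -> : (fun t => cis (- t) ^+ n) = (fun t => cis (- n%:R * t)).
  by apply/funext => s; rewrite cisX; congr cis; ring.
apply: (@cvg_comp _ _ _ (fun t => - n%:R * t) cis _ (nbhs (- n%:R * t))).
  exact: mulrl_continuous.
by rewrite cisX mulrN -mulNr; exact: continuous_cis.
Qed.

Lemma normc_mul_cisJ u w t n :
  normc (u * (w * cis (- t) ^+ n)) = normc u * normc w.
Proof. by rewrite !normcM normcX normc_cis expr1n mulr1. Qed.

(** The coefficients are recovered from the values on a circle: uniform
    convergence lets the integral be taken term by term. *)
Lemma circle_integral_psum c u rho n : disc_coef c -> 0 <= rho < 1 ->
  \int[leb]_(t in `[0, 2 * pi]) complex.Re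
    (u * (psum c ((rho%:C)%C * cis t) * cis (- t) ^+ n)) =
  2 * pi * (complex.Re (u * c n) * rho ^+ n).
Proof.
move=> tc r01; have [e e0 He] := psum_tail tc r01; have /andP[r0 r1] := r01.
set I := LHS; set V := RHS.
have cF := continuous_psum_circle tc r01.
suff IV N : (n < N)%N -> `|I - V| <= 2 * pi * (normc u * e N).
  apply/eqP; rewrite -subr_eq0 -normr_le0.
  have ce : (fun N => 2 * pi * (normc u * e N)) @ \oo --> (0 : R).
    rewrite -(mulr0 (2 * pi)); apply: cvgMr.
    by rewrite -(mulr0 (normc u)); apply: cvgMr.
  rewrite -(cvg_lim _ ce)//; apply: limr_ge; first by apply/cvg_ex; exists 0.
  by near=> N; apply: IV; near: N; exact: nbhs_infty_gt.
move=> nN.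
pose S t : cplx R := series (fun k => c k * ((rho%:C)%C * cis t) ^+ k) N.
have SE t : u * (S t * cis (- t) ^+ n) = \sum_(k <- index_iota 0 N)
    (u * c k * (rho ^+ k)%:C%C) * (cis t ^+ k * cis (- t) ^+ n).
  rewrite /S /series/= mulr_suml mulr_sumr; apply: eq_bigr => k _.
  by rewrite exprMn rmorphXn/=; ring.
have [/= cS IS] := circle_integral_trig (index_iota 0 N)
  (fun k => u * c k * (rho ^+ k)%:C%C) id (fun=> n).
have VE : V = \int[leb]_(t in `[0, 2 * pi])
    complex.Re (u * (S t * cis (- t) ^+ n)).
  under [in RHS]eq_Rintegral do rewrite SE.
  by rewrite IS big_nat1_eq nN /V Re_mul_real.
have cF' := continuous_Re_comp (@continuous_mul_cisJ _ u n cF).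
have cS' : continuous (fun t => complex.Re (u * (S t * cis (- t) ^+ n))).
  by under [X in continuous X]eq_fun do rewrite SE.
have cD : continuous (fun t => complex.Re
    (u * (psum c ((rho%:C)%C * cis t) * cis (- t) ^+ n)) -
    complex.Re (u * (S t * cis (- t) ^+ n))).
  by move=> t; apply: cvgB; [exact: cF'|exact: cS'].
have cA : continuous (fun t => `|complex.Re
    (u * (psum c ((rho%:C)%C * cis t) * cis (- t) ^+ n)) -
    complex.Re (u * (S t * cis (- t) ^+ n))|).
  by move=> t; apply: cvg_norm; exact: cD.
rewrite VE /I -RintegralB//; last 2 first.
- exact: circle_integrable cF'.
- exact: circle_integrable cS'.
apply: le_trans (le_normr_Rintegral _ _) _ => //.
  exact: circle_integrable cD.
rewrite -circle_integral_cst; apply: le_Rintegral => //.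
- exact: circle_integrable cA.
- by apply: circle_integrable => t; exact: cvg_cst.
move=> t _ /=.
rewrite -ReB -mulrBr -mulrBl.
apply: le_trans (normr_Re_le _) _.
rewrite normc_mul_cisJ ler_wpM2l ?normc_ge0//.
by apply: He; rewrite normc_circle.
Unshelve. all: by end_near. Qed.

(** The mean of [|f|] dominates every coefficient: test against the character
    [cis (- t) ^+ n], rotated by the phase of [c n]. *)
Lemma cauchy_estimate c rho n : disc_coef c -> 0 <= rho < 1 ->
  2 * pi * (normc (c n) * rho ^+ n) <=
  \int[leb]_(t in `[0, 2 * pi]) normc (psum c ((rho%:C)%C * cis t)).
Proof.
move=> tc r01; have [u u1 uc] := exists_phase (c n).
rewrite -uc -circle_integral_psum//.
have cF := continuous_psum_circle tc r01.
apply: le_Rintegral => //.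
- exact: circle_integrable (continuous_Re_comp (@continuous_mul_cisJ _ u n cF)).
- exact: circle_integrable (continuous_normc_comp cF).
by move=> t _; apply: le_trans (Re_le_normc _) _; rewrite normc_mul_cisJ u1 mul1r.
Qed.

(** Parseval's identity for polynomials, from the expansion of the squared
    modulus in characters, compared with the supremum over the circle. *)
Lemma sum_normc_sqr_le c rho (B : R) N : 0 <= rho ->
  (forall z, normc z = rho -> normc (\sum_(0 <= k < N) c k * z ^+ k) <= B) ->
  \sum_(0 <= k < N) normc (c k) ^+ 2 * rho ^+ (k + k) <= B ^+ 2.
Proof.
move=> r0 cB.
pose r := [seq (k, l) | k <- index_iota 0 N, l <- index_iota 0 N].
pose x (p : nat * nat) : cplx R :=
  c p.1 * ((c p.2)^*)%C * (rho ^+ (p.1 + p.2))%:C%C.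
have [/= cS IS] := circle_integral_trig r x (fun p => p.1) (fun p => p.2).
have SE t : complex.Re (\sum_(p <- r) x p * (cis t ^+ p.1 * cis (- t) ^+ p.2)) =
    normc (\sum_(0 <= k < N) c k * ((rho%:C)%C * cis t) ^+ k) ^+ 2.
  rewrite normc_sqrE; congr complex.Re.
  rewrite rmorph_sum big_distrlr/= big_allpairs/=.
  apply: eq_bigr => k _; apply: eq_bigr => l _.
  have -> : ((c l * ((rho%:C)%C * cis t) ^+ l)^*)%C =
      (c l)^*%C * ((rho ^+ l)%:C%C * cis (- t) ^+ l).
    rewrite exprMn -rmorphXn cisX !(rmorphM (@conjc R)); congr (_ * (_ * _)).
      exact: conjc_real.
    by rewrite cisX mulrN cisN.
  rewrite /x exprMn -rmorphXn /= exprD rmorphM /=; ring.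
rewrite -(@ler_pM2l _ (2 * pi)) ?mulr_gt0 ?pi_gt0//.
have -> : \sum_(0 <= k < N) normc (c k) ^+ 2 * rho ^+ (k + k) =
    \sum_(p <- r | p.1 == p.2) complex.Re (x p).
  rewrite [RHS]big_mkcond /r big_allpairs/=; apply: eq_big_nat => k kN.
  rewrite -big_mkcond/=.
  under eq_bigl do rewrite eq_sym.
  by rewrite big_nat1_eq kN /x/= Re_mul_real normc_sqrE.
rewrite -IS -circle_integral_cst; apply: le_Rintegral => //.
- exact: circle_integrable cS.
- by apply: circle_integrable => t; exact: cvg_cst.
move=> t _; rewrite SE /= lerXn2r ?nnegrE ?normc_ge0//; last first.
  by apply: cB; rewrite normc_circle.
by apply: le_trans (cB (rho%:C)%C _); rewrite ?normc_ge0// normc_real ger0_norm.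
Qed.

Lemma disc_coef1 : disc_coef (fun=> 1 : cplx R).
Proof.
move=> rho /andP[r0 r1]; exists 1 => n.
by rewrite normc1 mul1r exprn_ile1 ?ltW.
Qed.

Lemma psum1 w : normc w < 1 -> psum (fun=> 1) w = (1 - w)^-1.
Proof.
move=> w1; have w1' : 1 - w != 0.
  by rewrite subr_eq0; apply: contraTneq w1 => <-; rewrite normc1 ltxx.
apply: cvg_lim => //.
apply: (@cvg_normc_le _ _ _ _ _ _ (fun n => normc w ^+ n / normc (1 - w))).
  apply: nearW => n; rewrite -normcX -normcV -normcM -[leRHS]normcN.
  rewrite le_eqVlt; apply/orP; left; apply/eqP; congr normc.
  apply: (mulIf w1'); rewrite mulrBl mulVf// mulNr mulfVK//.
  rewrite /series/=; elim: n => [|n IH].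
    by rewrite big_nil mul0r sub0r expr0.
  rewrite big_nat_recr//= mulrDl mul1r addrAC IH exprS; ring.
rewrite -(mul0r (normc (1 - w))^-1); apply: cvgMl.
by apply: cvg_expr; rewrite ger0_norm ?normc_ge0.
Qed.

(** The mean of the Poisson kernel is the constant term of its expansion
    [Re (2 \sum w ^ n - 1)]. *)
Lemma poisson_kernel w : normc w < 1 ->
  (1 - normc w ^+ 2) / normc (1 - w) ^+ 2 = complex.Re (2 * psum (fun=> 1) w) - 1.
Proof.
move=> w1; rewrite psum1//; case: w w1 => a b /= w1.
have w2 : a ^+ 2 + b ^+ 2 < 1.
  by rewrite -(@ltr_sqrt _ _ 1)// sqrtr1.
have d0 : (1 - a) ^+ 2 + (- b) ^+ 2 != 0.
  by rewrite gt_eqF// sqrrN; nra.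
rewrite !sqr_sqrtr ?addr_ge0 ?sqr_ge0// sub0r.
rewrite !(mul0r, mulr0, subr0, addr0, add0r).
by field.
Qed.

Lemma circle_integral_poisson rho : 0 <= rho < 1 ->
  \int[leb]_(t in `[0, 2 * pi]) ((normc (1 - (rho%:C)%C * cis t) ^+ 2)^-1) =
  2 * pi / (1 - rho ^+ 2).
Proof.
move=> r01; have /andP[r0 r1] := r01.
have cF := continuous_psum_circle disc_coef1 r01.
have cF' := continuous_Re_comp (@continuous_mul_cisJ _ 2 0 cF).
have rr : 0 < 1 - rho ^+ 2 by rewrite subr_gt0 exprn_ilt1.
transitivity (\int[leb]_(t in `[0, 2 * pi]) ((1 - rho ^+ 2)^-1 *
    (complex.Re (2 * (psum (fun=> 1) ((rho%:C)%C * cis t) * cis (- t) ^+ 0))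
     - cst 1 t))).
  apply: eq_Rintegral => t _; rewrite expr0 mulr1 -poisson_kernel ?normc_circle//.
  by rewrite mulKf// gt_eqF.
have c1 : continuous (cst 1 : R -> R) by move=> t; exact: cvg_cst.
have cD : continuous (fun t => complex.Re
    (2 * (psum (fun=> 1) ((rho%:C)%C * cis t) * cis (- t) ^+ 0)) - cst 1 t).
  by move=> t; apply: cvgB; [exact: cF'|exact: c1].
rewrite RintegralZl//; last exact: circle_integrable cD.
rewrite RintegralB//; last 2 first.
- exact: circle_integrable cF'.
- exact: circle_integrable c1.
rewrite circle_integral_psum//; last exact: disc_coef1.
have -> : complex.Re (2 * 1 : cplx R) = 2.
  by rewrite mulr1 -[2]/(1 + 1) ReD.
rewrite circle_integral_cst expr0; ring.
Qed.

End CircleCoefficients.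

(** * The means of the second derivative *)

Section PowerSeriesNorms.
Context {R : realType}.
Implicit Types (c : nat -> cplx R) (z : cplx R).
Local Notation normc := (@Normc.normc R).
Local Notation leb := (@lebesgue_measure R).

Lemma analytic_psum c : disc_coef c -> analytic_on_disc (psum c).
Proof. by move=> tc z z1; have [] := is_derive_psum tc z1. Qed.

Lemma derive1_psum c z : disc_coef c -> normc z < 1 ->
  derive1 (psum c : cplx R -> cplx R) z = psum (dcoef c) z.
Proof.
move=> tc z1; rewrite derive1E.
by have Dz := is_derive_psum tc z1; rewrite derive_val.
Qed.

Lemma near_unit_disc z : normc z < 1 -> \forall w \near z, normc w < 1.
Proof.
move=> z1.
have /cvgrPdist_lt/(_ (1 - normc z)) : (fun w : cplx R => normc w) @ z --> normc z.
  by apply: (@cvg_normc _ (cplx R) (nbhs z) _ (fun w => w) z); exact: cvg_id.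
rewrite subr_gt0 => /(_ z1); apply: filterS => w.
by rewrite distrC ltr_distl => /andP[_]; rewrite addrC subrK.
Qed.

(** The first derivative is only known inside the disc; as the disc is open, this
    determines the second one. *)
Lemma derive1n2_psum c z : disc_coef c -> normc z < 1 ->
  derive1n 2 (psum c : cplx R -> cplx R) z = psum (dcoef (dcoef c)) z.
Proof.
move=> tc z1; have tdc := disc_coef_dcoef tc.
rewrite -(derive1_psum tdc z1) [LHS]derive1E [RHS]derive1E.
apply: near_eq_derive; near=> w.
rewrite derive1_psum//; near: w; exact: near_unit_disc.
Unshelve. all: by end_near. Qed.

Lemma M1_derive1n2_psum c (r : R) : disc_coef c -> 0 <= r < 1 ->
  M1 r (derive1n 2 (psum c : cplx R -> cplx R)) = ((2 * pi)^-1 *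
    \int[leb]_(t in `[0, 2 * pi])
       normc (psum (dcoef (dcoef c)) ((r%:C)%C * cis t)))%:E.
Proof.
move=> tc r01; have t2 := disc_coef_dcoef (disc_coef_dcoef tc).
have iF := circle_integrable (continuous_normc_comp (continuous_psum_circle t2 r01)).
rewrite /M1 EFinM; congr (_ * _)%E; rewrite /Rintegral fineK; last first.
  exact: integrable_fin_num iF.
apply: eq_integral => t _; rewrite -derive1n2_psum// normc_circle//.
  by case/andP: r01.
by case/andP: r01.
Qed.

End PowerSeriesNorms.

(** * Moments *)

Section Moments.
Context {R : realType}.
Variable mu : {finite_measure set R -> \bar R}.
Implicit Types (a : nat -> cplx R) (z w : cplx R) (t : R).
Local Notation normc := (@Normc.normc R).
Local Notation D := (`[0%R, 1%R[%classic : set R).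

Lemma finite_integrable (f : R -> R) (B : R) :
  measurable_fun D f -> (forall t, 0 <= t < 1 -> `|f t| <= B) ->
  mu.-integrable D (EFin \o f).
Proof.
move=> mf fB; apply: measurable_bounded_integrable => //.
- by rewrite ltey_eq fin_num_measure.
- exists B; split; first exact: num_real.
  move=> M BM t /=; rewrite in_itv/= => /fB; move/le_trans; apply; exact: ltW.
Qed.

Lemma moment_integrable n : mu.-integrable D (EFin \o (fun t => t ^+ n)).
Proof.
apply: (@finite_integrable _ 1).
  exact: exprn_measurable.
by move=> t /andP[t0 t1]; rewrite ger0_norm ?exprn_ge0// exprn_ile1// ltW.
Qed.

Lemma moment_ge0 n : 0 <= moment mu n.
Proof.
by apply: Rintegral_ge0 => t /=; rewrite in_itv/= => /andP[t0 _]; exact: exprn_ge0.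
Qed.

Lemma moment_le m n : (m <= n)%N -> moment mu n <= moment mu m.
Proof.
move=> mn; apply: le_Rintegral => //; try exact: moment_integrable.
move=> t /=; rewrite in_itv/= => /andP[t0 t1].
by rewrite ler_wiXn2l// ltW.
Qed.

Lemma Rintegral_moments I (r : seq I) (x : I -> R) (e : I -> nat) :
  mu.-integrable D (EFin \o (fun t => \sum_(i <- r) x i * t ^+ e i)) /\
  \int[mu]_(t in D) (\sum_(i <- r) x i * t ^+ e i) =
    \sum_(i <- r) x i * moment mu (e i).
Proof.
have ix i : mu.-integrable D (EFin \o (fun t => x i * t ^+ e i)).
  rewrite (_ : _ \o _ = (fun t => (x i)%:E * (t ^+ e i)%:E)%E)//.
  by apply: integrableZl => //; exact: moment_integrable.
elim: r => [|i r [IHi IH]].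
  under eq_Rintegral do rewrite big_nil.
  rewrite Rintegral_cst// mul0r big_nil; split=> //.
  rewrite (_ : _ \o _ = cst 0%E); first exact: integrable0.
  by apply/funext => t /=; rewrite big_nil.
have E : (fun t => \sum_(j <- i :: r) x j * t ^+ e j) =
    (fun t => x i * t ^+ e i + \sum_(j <- r) x j * t ^+ e j).
  by apply/funext => t; rewrite big_cons.
rewrite E; split.
  exact: (integrableD (measurable_itv _) (ix i) IHi).
rewrite RintegralD// IH RintegralZl//; last exact: moment_integrable.
by rewrite big_cons.
Qed.

Lemma continuous_cplx_poly I (r : seq I) (x : I -> cplx R) (e : I -> nat) :
  continuous (fun t : R => (\sum_(i <- r) x i * ((t ^+ e i)%:C)%C : cplx R)).
Proof.
elim: r => [|i r IH].
  rewrite (_ : (fun t => _) = cst 0); first by move=> t; exact: cvg_cst.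
  by apply/funext => t; rewrite big_nil.
rewrite (_ : (fun t => _) = (fun t => x i * ((t ^+ e i)%:C)%C +
  \sum_(j <- r) x j * ((t ^+ e j)%:C)%C)); last first.
  by apply/funext => t; rewrite big_cons.
move=> t; apply: cvgD; last exact: IH.
apply: cvgMr; apply: (@cvg_normc_le _ _ (nbhs t) _ (fun s => ((s ^+ e i)%:C)%C : cplx R)
   _ (fun s => `|s ^+ e i - t ^+ e i|)).
  apply: nearW => s; rewrite -normc_real.
  by rewrite (rmorphB (real_complex R)).
rewrite -(normr0 R) -(subrr (t ^+ e i)); apply: cvg_norm.
by apply: cvgB; [exact: exprn_continuous|exact: cvg_cst].
Qed.

Lemma normc_poly_integrable I (r : seq I) (x : I -> cplx R) (e : I -> nat) :
  mu.-integrable D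
    (EFin \o (fun t => normc (\sum_(i <- r) x i * ((t ^+ e i)%:C)%C))).
Proof.
apply: (@finite_integrable _ (\sum_(i <- r) normc (x i))).
  apply: measurable_funTS; apply: continuous_measurable_fun.
  by apply: continuous_normc_comp; exact: continuous_cplx_poly.
move=> t /andP[t0 t1]; rewrite ger0_norm ?normc_ge0//.
apply: le_trans (ler_normc_sum _ _ _) _; apply: ler_sum => i _.
rewrite normcM normc_real ler_piMr ?normc_ge0//.
by rewrite ger0_norm ?exprn_ge0// exprn_ile1// ltW.
Qed.

(** The triangle inequality for the integral of a complex polynomial, expressed
    through real integrals only by fixing the phase of the left-hand side. *)
Lemma normc_sum_moment_le I (r : seq I) (x : I -> cplx R) (e : I -> nat) :
  normc (\sum_(i <- r) x i * ((moment mu (e i))%:C)%C) <=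
  \int[mu]_(t in D) normc (\sum_(i <- r) x i * ((t ^+ e i)%:C)%C).
Proof.
have [u u1 <-] := exists_phase (\sum_(i <- r) x i * ((moment mu (e i))%:C)%C).
have ReE (m : nat -> R) : complex.Re (u * \sum_(i <- r) x i * ((m (e i))%:C)%C) =
    \sum_(i <- r) complex.Re (u * x i) * m (e i).
  by rewrite mulr_sumr Re_sum; apply: eq_bigr => i _; rewrite mulrA Re_mul_real.
have [ii iE] := Rintegral_moments r (fun i => complex.Re (u * x i)) e.
rewrite ReE -iE; apply: le_Rintegral => //; first exact: normc_poly_integrable.
move=> t _; rewrite -(ReE (fun n => t ^+ n)).
by apply: le_trans (Re_le_normc _) _; rewrite normcM u1 mul1r.
Qed.

End Moments.

(** * Dilation and square summability *)

Section BoundedFunctions.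
Context {R : realType}.
Implicit Types (a : nat -> cplx R) (z : cplx R).
Local Notation normc := (@Normc.normc R).

Lemma bernoulli_le (s : R) n : 0 <= s <= 1 -> 1 - n%:R * (1 - s) <= s ^+ n.
Proof.
move=> /andP[s0 s1]; elim: n => [|n IH]; first by rewrite mul0r subr0 expr0.
rewrite exprS -natr1; have : 0 <= n%:R :> R by [].
move: (n%:R) (s ^+ n) IH => x y /(ler_wpM2l s0) IH x0.
by have := mulr_ge0 x0 (sqr_ge0 (1 - s)); nra.
Qed.

(** Abel's theorem: dilating by [s] close to [1] changes a convergent series
    little, uniformly over its partial sums. *)
Lemma abel_dilation (m : nat -> R) (K eta : R) : (forall n, 0 <= m n) ->
  (forall N, \sum_(0 <= n < N) m n <= K) -> 0 < eta ->
  exists2 s : R, 0 <= s < 1 &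
    forall N, \sum_(0 <= n < N) (1 - s ^+ n) * m n <= eta.
Proof.
move=> m0 mK eta0.
have K0 : 0 <= K by apply: le_trans (mK 0%N); rewrite big_nil.
have ndm : nondecreasing_seq (series m).
  by apply: nondecreasing_series => n _ _; exact: m0.
have cm : cvgn (series m).
  by apply: nondecreasing_is_cvgn => //; exists K => _ [N _ <-]; exact: mK.
have [N0 HN0] : exists N0, limn (series m) - series m N0 < eta / 2.
  have /cvgrPdist_lt/(_ (eta / 2)) := cm; rewrite divr_gt0// => /(_ isT)[N0 _].
  move=> /(_ N0 (leqnn _)) H; exists N0; exact: le_lt_trans (ler_norm _) H.
(* The tail after [N0] is at most [eta / 2]; this [d] makes the change of each of
   the first [N0] terms, at most [N0 * d] times the term by Bernoulli, add up to
   at most [eta / 2] as well, and stays below [1]. *)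
pose d := eta / (2 * (N0%:R * K + eta)).
have NK : 0 <= N0%:R * K by rewrite mulr_ge0.
have den : 0 < 2 * (N0%:R * K + eta) by lra.
have d0 : 0 < d by rewrite divr_gt0.
have dK : N0%:R * K * d <= eta / 2.
  rewrite mulrA ler_pdivrMr// (_ : eta / 2 * _ = eta * (N0%:R * K + eta)).
    by rewrite mulrC ler_wpM2l ?ltW//; lra.
  by field.
have d1 : d < 1 by rewrite ltr_pdivrMr// mul1r; lra.
have s01 : 0 <= 1 - d <= 1 by apply/andP; split; lra.
exists (1 - d); first by apply/andP; split; lra.
have le1 n : (1 - d) ^+ n <= 1 by case/andP: s01 => ? ?; rewrite exprn_ile1.
have ge0 n : 0 <= (1 - d) ^+ n by case/andP: s01 => ? ?; rewrite exprn_ge0.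
move=> N; apply: (@le_trans _ _
    (\sum_(0 <= n < N0 + N) (1 - (1 - d) ^+ n) * m n)).
  rewrite [leRHS](@big_cat_nat _ _ _ N)//= ?leq_addl// lerDl.
  by apply: sumr_ge0 => n _; rewrite mulr_ge0 ?subr_ge0.
rewrite (@big_cat_nat _ _ _ N0)//= ?leq_addr// [leRHS](splitr eta); apply: lerD.
  apply: le_trans dK; rewrite mulrAC.
  apply: le_trans (ler_wpM2l _ (mK N0)); last by rewrite mulr_ge0// ltW.
  rewrite mulr_sumr; apply: ler_sum_nat => n /andP[_ nN].
  rewrite ler_wpM2r//; have := bernoulli_le n s01.
  have : n%:R <= N0%:R :> R by rewrite ler_nat ltnW.
  by move: (n%:R) ((1 - d) ^+ n) (N0%:R) => x y w; nra.
apply: (@le_trans _ _ (\sum_(N0 <= n < N0 + N) m n)).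
  by apply: ler_sum_nat => n _; rewrite ler_piMl// gerBl.
have : series m (N0 + N)%N <= limn (series m) by exact: nondecreasing_cvgn_le.
rewrite {1}/series/= (@big_cat_nat _ _ _ N0)//= ?leq_addr//.
by move: HN0; rewrite {2}/series/=; lra.
Qed.

(** A bounded function has square summable coefficients. The constant is not
    sharp: the slack absorbs the truncation error and the dilation. *)
Lemma sum_sqr_coef_le a (B : R) N : disc_coef a ->
  (forall z, normc z < 1 -> normc (psum a z) <= B) ->
  \sum_(0 <= k < N) normc (a k) ^+ 2 <= 2 * (B + 1) ^+ 2.
Proof.
move=> ta aB.
have N1 : 1 <= N.+1%:R :> R by rewrite ler1n.
have [w [w0 wN w4]] : exists w : R, [/\ 0 < w, w * N.+1%:R = 4^-1 & w <= 4^-1].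
  have w0 : 0 < (4 * N.+1%:R)^-1 :> R by rewrite invr_gt0; lra.
  have wN : (4 * N.+1%:R)^-1 * N.+1%:R = 4^-1 :> R.
    by field; rewrite gt_eqF//; lra.
  by exists (4 * N.+1%:R)^-1; split=> //; rewrite -wN ler_peMr// ltW.
(* By Bernoulli, [rho ^+ (2 * N)] is at least [1 / 2] for this radius. *)
pose rho : R := 1 - w.
have r0 : 0 <= rho by rewrite /rho; lra.
have r1 : rho < 1 by rewrite /rho; lra.
have r01 : 0 <= rho < 1 by rewrite r0.
have [e e0 He] := psum_tail ta r01.
have [N' [NN' eN']] : exists N', (N <= N')%N /\ e N' <= 1.
  have /cvgrPdist_lt/(_ 1 ltr01)[N1' _ HN] := e0.
  exists (maxn N N1'); split; first exact: leq_maxl.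
  have := HN _ (leq_maxr N N1'); rewrite sub0r normrN => /ltW; apply: le_trans.
  exact: ler_norm.
have H : \sum_(0 <= k < N') normc (a k) ^+ 2 * rho ^+ (k + k) <= (B + 1) ^+ 2.
  apply: sum_normc_sqr_le => // z zr.
  have zr' : normc z <= rho by rewrite zr.
  have := He z N' zr'; have := aB z (le_lt_trans zr' r1).
  rewrite normcB => h1 h2; have := ler_dist_normc
    (series (fun k => a k * z ^+ k) N') (psum a z).
  by rewrite /series/= in h2 *; lra.
have HN : \sum_(0 <= k < N) normc (a k) ^+ 2 * 2^-1 <= (B + 1) ^+ 2.
  apply: le_trans H; rewrite [leRHS](@big_cat_nat _ _ _ N)//=.
  rewrite -[leLHS]addr0; apply: lerD; last first.
    by apply: sumr_ge0 => n _; rewrite mulr_ge0 ?sqr_ge0 ?exprn_ge0.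
  apply: ler_sum_nat => k /andP[_ kN]; rewrite ler_wpM2l ?sqr_ge0//.
  have r01' : 0 <= rho <= 1 by rewrite r0 ltW.
  apply: le_trans (bernoulli_le (k + k) r01').
  have kN' : (k + k)%:R <= 2 * N.+1%:R :> R by rewrite -natrM ler_nat; lia.
  rewrite (_ : 1 - rho = w); last by rewrite /rho; ring.
  by move: (N.+1%:R) ((k + k)%:R) kN' wN => x y; nra.
by rewrite -mulr_suml in HN; lra.
Qed.

(** The terms are dominated by a telescoping sum, which appears in the sharper
    bound [2 - 1 / N] proved by induction. *)
Lemma sum_inv_sqr_le N : \sum_(0 <= k < N) (k.+1%:R^-1) ^+ 2 <= 2 :> R.
Proof.
suff H M : \sum_(0 <= k < M.+1) (k.+1%:R^-1) ^+ 2 <= 2 - M.+1%:R^-1 :> R.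
  case: N => [|N]; first by rewrite big_nil.
  by apply: le_trans (H N) _; rewrite gerBl invr_ge0.
elim: M => [|M IH]; first by rewrite big_nat1 invr1 expr1n; lra.
rewrite big_nat_recr//=; apply: le_trans (lerD IH (lexx _)) _.
have M0 : 0 < M.+1%:R :> R by rewrite ltr0n.
rewrite -[M.+2%:R]natr1; move: (M.+1%:R) M0 => x x0.
rewrite -subr_ge0 (_ : _ - _ = (x * (x + 1) ^+ 2)^-1).
  by rewrite invr_ge0 mulr_ge0 ?sqr_ge0 ?ltW.
by field; rewrite !gt_eqF//; lra.
Qed.

End BoundedFunctions.

(** * Coefficients of the transform *)

Section HilbertCoefficients.
Context {R : realType}.
Variable mu : {finite_measure set R -> \bar R}.
Implicit Types (a : nat -> cplx R) (z w : cplx R) (t : R).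
Local Notation normc := (@Normc.normc R).
Local Notation D := (`[0%R, 1%R[%classic : set R).

(** Moments of size [1 / k] and square summable coefficients are matched by the
    inequality [2 x y <= x ^ 2 + y ^ 2]; so the series defining the transform of a
    bounded function converges absolutely. *)
Lemma sum_moment_coef_le a (A B : R) : disc_coef a ->
  (forall z, normc z < 1 -> normc (psum a z) <= B) ->
  (forall k, moment mu k <= A / k.+1%:R) ->
  exists K, forall N, \sum_(0 <= k < N) moment mu k * normc (a k) <= K.
Proof.
move=> ta aB mA; exists (A ^+ 2 * 2 + 2 * (B + 1) ^+ 2) => N.
apply: (@le_trans _ _ (\sum_(0 <= k < N)
    (A ^+ 2 * (k.+1%:R^-1) ^+ 2 + normc (a k) ^+ 2))).
  apply: ler_sum_nat => k _; have := mA k; have := moment_ge0 mu k.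
  have := normc_ge0 (a k); move: (normc _) (moment _ _) (_^-1) => x y u x0 y0 yu.
  by have := ler_pM y0 y0 yu yu; have := sqr_ge0 (x - y); nra.
rewrite big_split/= -mulr_sumr lerD ?sum_sqr_coef_le//.
by rewrite ler_wpM2l ?sqr_ge0// sum_inv_sqr_le.
Qed.

Variables (a : nat -> cplx R) (K : R).
Hypothesis aK : forall N, \sum_(0 <= k < N) moment mu k * normc (a k) <= K.

Lemma cvg_hilbert_coef n : hilbert_coef_series mu a n @ \oo --> hilbert_coef mu a n.
Proof.
apply: (@cvg_series_bounded _ _ K) => N; apply: le_trans (aK N).
apply: ler_sum_nat => k _; rewrite normcM normc_real ger0_norm ?moment_ge0//.
by rewrite ler_wpM2r ?normc_ge0// moment_le// leq_addl.
Qed.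

Lemma cvg_sum_hilbert_coef I (r : seq I) (x : I -> cplx R) (e : I -> nat) :
  (fun N => \sum_(i <- r) x i * hilbert_coef_series mu a (e i) N) @ \oo -->
  (\sum_(i <- r) x i * hilbert_coef mu a (e i) : cplx R).
Proof.
by apply: cvg_big => [|i _]; [exact: add_continuous|apply: cvgMr; exact: cvg_hilbert_coef].
Qed.

Variable B : R.
Hypotheses (ta : disc_coef a) (aB : forall z, normc z < 1 -> normc (psum a z) <= B).

(** The coefficients of the transform are the integrals of [f t * t ^+ n]
    against [mu], where [f] is the function with coefficients [a]; so a
    combination of them is bounded by [sup |f|]. The partial sums of [f] need
    not be bounded by [B], hence the dilation by [s]. *)
Lemma normc_sum_hilbert_coef_le I (r : seq I) (x : I -> cplx R) (e : I -> nat) :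
  normc (\sum_(i <- r) x i * hilbert_coef mu a (e i)) <=
  B * \int[mu]_(t in D) normc (\sum_(i <- r) x i * ((t ^+ e i)%:C)%C).
Proof.
set Q : R -> cplx R := fun t => \sum_(i <- r) x i * ((t ^+ e i)%:C)%C.
have iQ : mu.-integrable D (EFin \o (fun t => normc (Q t))).
  exact: normc_poly_integrable.
set IQ := \int[mu]_(t in D) normc (Q t).
pose beta := \sum_(i <- r) normc (x i).
have beta0 : 0 <= beta by apply: sumr_ge0 => i _; exact: normc_ge0.
suff main (eta : R) : 0 < eta ->
    normc (\sum_(i <- r) x i * hilbert_coef mu a (e i)) <= B * IQ + eta * beta.
  apply/ler_addgt0Pr => eps eps0.
  have b1 : 0 < beta + 1 by lra.
  apply: le_trans (main (eps / (beta + 1)) _) _; first by rewrite divr_gt0.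
  rewrite lerD2l mulrAC ler_pdivrMr// ler_pM2l//; lra.
move=> eta0.
have m0 k : 0 <= moment mu k * normc (a k) by rewrite mulr_ge0 ?moment_ge0 ?normc_ge0.
have [s s01 Hs] := abel_dilation m0 aK eta0.
have [er er0 Her] := psum_tail ta s01.
have /andP[s0 s1] := s01.
pose c i k : cplx R := x i * (((moment mu (e i + k))%:C)%C * a k).
have Ts N : normc (\sum_(i <- r) \sum_(0 <= k < N) c i k * ((s ^+ k)%:C)%C) <=
    (B + er N) * IQ.
  pose rp := [seq (i, k) | i <- r, k <- index_iota 0 N].
  pose xp (p : I * nat) : cplx R := x p.1 * a p.2 * ((s ^+ p.2)%:C)%C.
  have -> : \sum_(i <- r) \sum_(0 <= k < N) c i k * ((s ^+ k)%:C)%C =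
      \sum_(p <- rp) xp p * ((moment mu (e p.1 + p.2))%:C)%C.
    rewrite big_allpairs; apply: eq_bigr => i _; apply: eq_bigr => k _.
    by rewrite /c /xp/=; ring.
  apply: le_trans (normc_sum_moment_le _ _ _ _) _.
  rewrite -RintegralZl//; apply: le_Rintegral => //.
  - exact: normc_poly_integrable.
  - exact: (integrableZl (measurable_itv _) (B + er N) iQ).
  move=> t /=; rewrite in_itv/= => /andP[t0 t1].
  have -> : \sum_(p <- rp) xp p * ((t ^+ (e p.1 + p.2))%:C)%C =
      Q t * series (fun k => a k * (((s * t)%:C)%C) ^+ k) N.
    rewrite /series/= big_distrlr/= big_allpairs; apply: eq_bigr => i _.
    apply: eq_bigr => k _.
    by rewrite /xp/= -rmorphXn exprMn exprD !rmorphM/=; ring.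
  rewrite normcM mulrC ler_wpM2r ?normc_ge0//.
  have st : normc ((s * t)%:C)%C <= s.
    by rewrite normc_real ger0_norm ?mulr_ge0// ler_piMr// ltW.
  have := Her _ N st; have := aB (le_lt_trans st s1).
  rewrite normcB => h1 h2; have := ler_dist_normc
    (series (fun k => a k * (((s * t)%:C)%C) ^+ k) N) (psum a ((s * t)%:C)%C).
  lra.
have cR : (fun N => (B + er N) * IQ + eta * beta) @ \oo --> B * IQ + eta * beta.
  apply: cvgD; last exact: cvg_cst.
  apply: cvgMl; rewrite -[X in _ --> X]addr0.
  by apply: cvgD => //; exact: cvg_cst.
have cL := @cvg_normc _ _ \oo _ _ _ (@cvg_sum_hilbert_coef _ r x e).
(* At each rank the dilated sum carries the bound by [B], and the remaining part
   is small by Abel's theorem. *)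
refine (ler_cvg_to (cL _) cR _).
apply: nearW => N.
have -> : \sum_(i <- r) x i * hilbert_coef_series mu a (e i) N =
    \sum_(i <- r) \sum_(0 <= k < N) c i k * ((s ^+ k)%:C)%C +
    \sum_(i <- r) \sum_(0 <= k < N) c i k * ((1 - s ^+ k)%:C)%C.
  rewrite -big_split/=; apply: eq_bigr => i _; rewrite -big_split/=.
  rewrite /hilbert_coef_series /series/= mulr_sumr; apply: eq_bigr => k _.
  by rewrite rmorphB/= rmorph1 /c -mulrDr addrC subrK mulr1.
apply: le_trans (ler_normcD _ _) _; apply: lerD; first exact: Ts.
apply: le_trans (ler_normc_sum _ _ _) _.
rewrite /beta mulr_sumr; apply: ler_sum => i _.
apply: le_trans (ler_normc_sum _ _ _) _.
apply: le_trans (ler_wpM2r (normc_ge0 _) (Hs N)).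
rewrite mulr_suml; apply: ler_sum => k _.
have sk : 0 <= 1 - s ^+ k by rewrite subr_ge0 exprn_ile1// ltW.
rewrite /c !normcM !normc_real !ger0_norm ?moment_ge0//.
rewrite mulrC [leRHS]mulrC mulrCA ler_wpM2l ?normc_ge0// ler_wpM2l//.
by rewrite ler_wpM2r ?normc_ge0// moment_le// leq_addl.
Qed.

End HilbertCoefficients.

(** * The Carleson integral *)

Section CarlesonEstimates.
Context {R : realType}.
Variable mu : {finite_measure set R -> \bar R}.
Implicit Types (t r : R).
Local Notation D := (`[0%R, 1%R[%classic : set R).

(** The inverse is measurable on the whole line because, at [0] too, it equals
    [x] times a real power of the nonnegative number [x ^+ 2]. *)
Lemma measurable_invr : measurable_fun setT (@GRing.inv R).
Proof.
rewrite (_ : @GRing.inv R = (fun x => x * (x ^+ 2) `^ (-1))).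
  apply: measurable_funM => //.
  exact: (measurableT_comp (measurable_powR _) (exprn_measurable _)).
apply/funext => x; rewrite powR_inv1 ?sqr_ge0// expr2.
have [->|x0] := eqVneq x 0; first by rewrite invr0 mul0r.
by rewrite invfM mulrA divff// mul1r.
Qed.

Lemma kernel_sqr_integrable r : 0 <= r < 1 ->
  mu.-integrable D (EFin \o (fun t => ((1 - r * t) ^+ 2)^-1)).
Proof.
move=> /andP[r0 r1]; apply: (@finite_integrable _ _ _ ((1 - r) ^+ 2)^-1).
  apply: (measurable_funTS (measurableT_comp measurable_invr _)).
  apply: continuous_measurable_fun => t.
  have c1 : (fun s => 1 - r * s) @ t --> 1 - r * t.
    apply: cvgB; first exact: cvg_cst.
    exact: mulrl_continuous.
  exact: (cvg_comp _ _ c1 (@exprn_continuous R 2 _)).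
move=> t /andP[t0 t1]; rewrite ger0_norm ?invr_ge0 ?sqr_ge0//.
have rt : r * t <= r by rewrite ler_piMr// ltW.
rewrite lef_pV2 ?posrE ?exprn_gt0//; try lra.
by rewrite lerXn2r ?nnegrE; lra.
Qed.

(** Where [2 ^ - (j + 1) < 1 - t <= 2 ^ - j], the left-hand side is at most
    [4 ^ (j + 1)], and the lower bound on [x] ends the dyadic decomposition at
    [J]: the layer-cake formula becomes a finite sum. *)
Lemma inv_sqr_le_dyadic t (x : R) J : 0 <= t -> 0 < x -> 1 - t <= x ->
  2^-1 ^+ J.+1 <= x ->
  (x ^+ 2)^-1 <= \sum_(0 <= j < J.+1) 4 ^+ j.+1 * (1 - 2^-1 ^+ j <= t)%R%:R.
Proof.
move=> t0 x0 tx.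
have inv4 j : 2^-1 ^+ j.+1 <= x -> (x ^+ 2)^-1 <= 4 ^+ j.+1.
  move=> jx; rewrite (_ : 4 ^+ j.+1 = ((2^-1 ^+ j.+1) ^+ 2)^-1); last first.
    by rewrite -exprM mulnC exprM -[RHS]exprVn; congr (_ ^+ _); field.
  rewrite lef_pV2 ?posrE ?exprn_gt0//.
  by rewrite lerXn2r ?nnegrE ?(ltW x0)// exprn_ge0// invr_ge0.
elim: J => [|J IH] Jx.
  rewrite big_nat1 (_ : (_ <= t) = true) ?mulr1; first exact: inv4.
  by rewrite expr0 subrr.
rewrite big_nat_recr//=; have [Jx'|Jx'] := leP (2^-1 ^+ J.+1) x.
  by apply: le_trans (IH Jx') _; rewrite lerDl mulr_ge0 ?exprn_ge0.
rewrite (_ : (_ <= t) = true) ?mulr1; last by apply/idP; lra.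
apply: le_trans (inv4 _ Jx) _; rewrite lerDr; apply: sumr_ge0 => j _.
by rewrite mulr_ge0 ?exprn_ge0.
Qed.

Lemma dyadic_scale (d : R) : 0 < d <= 1 ->
  exists J, 2^-1 ^+ J.+1 <= d /\ d <= 2^-1 ^+ J.
Proof.
move=> /andP[d0 d1].
have exP : exists n, 2^-1 ^+ n.+1 <= d.
  have /cvgrPdist_lt/(_ d d0)[N _ HN] :
      (fun n => 2^-1 ^+ n : R) @ \oo --> (0 : R).
    by apply: cvg_expr; rewrite ger0_norm//; lra.
  exists N; have := HN N.+1 (leqnSn N); rewrite sub0r normrN => /ltW.
  exact/le_trans/ler_norm.
case: (ex_minnP exP) => [[|J] HJ Jmin]; first by exists 0%N; rewrite expr0.
exists J.+1; split=> //; have [//|dJ] := leP d (2^-1 ^+ J.+1).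
by have := Jmin J (ltW dJ); rewrite ltnn.
Qed.

Variable C : R.
Hypothesis C0 : 0 < C.
Hypothesis muC : forall t : R, 0 <= t < 1 ->
  (mu `[t, 1%R[%classic <= (C * (1 - t))%:E)%E.

(** Each dyadic layer contributes at most [4 C 2 ^ j], so the sum is of the
    order of its last term, where [2 ^ - j] is comparable to [1 - r]. *)
Lemma carleson_kernel_le r : 0 <= r < 1 ->
  \int[mu]_(t in D) ((1 - r * t) ^+ 2)^-1 <= 8 * C / (1 - r).
Proof.
move=> r01; have /andP[r0 r1] := r01.
have ik := kernel_sqr_integrable r01.
have [J [Jr rJ]] : exists J, 2^-1 ^+ J.+1 <= 1 - r /\ 1 - r <= 2^-1 ^+ J.
  by apply: dyadic_scale; apply/andP; split; lra.
pose A j : set R := `[1 - 2^-1 ^+ j, 1[%classic.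
have mA j : measurable (A j) by exact: measurable_itv.
have m1 j : measurable_fun D (fun t => (\1_(A j) t)%:E : \bar R).
  by apply/measurable_EFinP; apply: measurable_indic.
rewrite -lee_fin fineK; last exact: integrable_fin_num ik.
apply: (@le_trans _ _ (\int[mu]_(t in D)
   (\sum_(0 <= j < J.+1) (4 ^+ j.+1)%:E * (\1_(A j) t)%:E))%E).
  apply: ge0_le_integral => //.
  - by move=> t _; rewrite lee_fin invr_ge0 sqr_ge0.
  - exact: measurable_int ik.
  - apply: emeasurable_sum => j; exact: measurable_funeM.
  move=> t /=; rewrite in_itv/= => /andP[t0 t1].
  have rt : r * t <= r by rewrite ler_piMr// ltW.
  have rt' : r * t <= t by rewrite ler_piMl// ltW.
  rewrite sumEFin lee_fin.
  apply: le_trans (inv_sqr_le_dyadic t0 _ _ (_ : 2^-1 ^+ J.+1 <= _)) _; try lra.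
  apply: ler_sum_nat => j _.
  rewrite ler_wpM2l ?exprn_ge0// indicE.
  have [jt|//] := boolP (1 - 2^-1 ^+ j <= t).
  by rewrite mem_set// /A/= in_itv/= jt t1.
rewrite ge0_integral_sum//; last by move=> j; exact: measurable_funeM.
apply: (@le_trans _ _ (\sum_(0 <= j < J.+1) (4 * C * 2 ^+ j)%:E)%E).
  apply: lee_sum => j _; rewrite ge0_integralZl_EFin ?exprn_ge0//.
  rewrite integral_indic//.
  have j01 : 0 <= 1 - (2^-1 : R) ^+ j < 1.
    apply/andP; split; last by rewrite gtrBl exprn_gt0// invr_gt0.
    by rewrite subr_ge0 exprn_ile1//; lra.
  apply: (@le_trans _ _ ((4 ^+ j.+1)%:E * (C * (1 - (1 - 2^-1 ^+ j)))%:E)%E).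
    rewrite lee_wpmul2l ?lee_fin ?exprn_ge0//.
    apply: le_trans (muC j01); apply: le_measure; rewrite ?inE//.
    by apply: measurableI.
  rewrite -EFinM lee_fin subKr exprS (_ : 4 ^+ j = 2 ^+ j * 2 ^+ j); last first.
    by rewrite -exprMn; congr (_ ^+ _); ring.
  rewrite exprVn le_eqVlt; apply/orP; left; apply/eqP; field.
  by rewrite expf_neq0.
rewrite sumEFin lee_fin -mulr_sumr ler_pdivlMr ?subr_gt0//.
have -> : \sum_(0 <= j < J.+1) 2 ^+ j = 2 * 2 ^+ J - 1 :> R.
  elim: (J) => [|k IH]; first by rewrite big_nat1 expr0; lra.
  by rewrite big_nat_recr//= IH exprS; ring.
have J0 : 0 < 2 ^+ J :> R by rewrite exprn_gt0.
have : 2 ^+ J * (1 - r) <= 1.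
  by rewrite -ler_pdivlMl// mulr1 -exprVn.
move: (2 ^+ J) J0 => y y0 yr.
have := mulr_ge0 (ltW C0) (ltW y0); have : 0 < 1 - r by lra.
move: (1 - r) yr => d yd d0 _.
rewrite (_ : _ * d = 8 * C * (y * d) - 4 * C * d); last ring.
by have := mulr_gt0 C0 d0; nra.
Qed.

(** With [n] half of [k] and [1 - r = 1 / (n + 1)], the monomial [t ^+ (n + n)] is
    at most [4 / (n + 1) ^ 2] times the kernel, which reduces the bound on the
    moment to the kernel estimate. *)
Lemma carleson_moment_le k : moment mu k <= 64 * C / k.+1%:R.
Proof.
pose n := k./2; have nk : (n + n <= k)%N by rewrite addnn /n halfK leq_subr.
have kn : (k.+1 <= 2 * n.+1)%N.
  rewrite /n; have := odd_double_half k; rewrite -muln2.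
  by move: (k./2) => h; case: (odd k); rewrite ?add0n ?add1n; lia.
have n1 : 1 <= n.+1%:R :> R by rewrite ler1n.
have n0 : n.+1%:R != 0 :> R by rewrite pnatr_eq0.
have [v [v0 v1 vE]] : exists v : R, [/\ 0 < v, v <= 1 & v * n.+1%:R = 1].
  exists n.+1%:R^-1; split; last exact: mulVf.
    by rewrite invr_gt0 ltr0n.
  by rewrite invf_le1// ltr0n.
pose r : R := 1 - v.
have r01 : 0 <= r < 1 by rewrite /r; apply/andP; split; lra.
have ik := kernel_sqr_integrable r01.
apply: le_trans (moment_le mu nk) _.
apply: (@le_trans _ _ (4 * v ^+ 2 * (8 * C / (1 - r)))).
  apply: le_trans (ler_wpM2l _ (carleson_kernel_le r01)).
    2: by rewrite mulr_ge0 ?sqr_ge0.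
  rewrite -RintegralZl//; apply: le_Rintegral => //.
  - exact: moment_integrable.
  - exact: (integrableZl (measurable_itv _) _ ik).
  move=> t /=; rewrite in_itv/= => /andP[t0 t1].
  have tr0 : 0 < 1 - r * t by case/andP: r01 => ? ?; nra.
  rewrite ler_pdivlMr ?exprn_gt0//.
  rewrite exprD -!expr2 -!exprMn (_ : 4 = 2 ^+ 2) -?exprMn; last by ring.
  have hv : 0 <= 2 * v by rewrite mulr_ge0// ltW.
  have ht : 0 <= t ^+ n * (1 - r * t) by rewrite mulr_ge0 ?exprn_ge0// ltW.
  rewrite lerXn2r ?nnegrE//.
  rewrite -(ler_pM2r (lt_le_trans ltr01 n1)) -[leRHS]mulrA vE mulr1.
  have E : (1 - r * t) * n.+1%:R = n.+1%:R * (1 - t) + t.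
    transitivity (n.+1%:R * (1 - t) + t * (v * n.+1%:R)); first by rewrite /r; ring.
    by rewrite vE mulr1.
  rewrite -mulrA E.
  rewrite (_ : _ + t = 1 + n%:R * (1 - t)); last by rewrite -natr1; ring.
  (* A Bernoulli inequality for the inverse power of [t]. *)
  suff : t ^+ n * (1 + n%:R * (1 - t)) <= 1 by lra.
  elim: (n) => [|m IH]; first by rewrite expr0 mul0r addr0 mulr1.
  have : 0 <= m%:R :> R by [].
  have : 0 <= t ^+ m by rewrite exprn_ge0.
  rewrite exprS -natr1; move: (t ^+ m) (m%:R) IH => x y IH x0 y0.
  by have := mulr_ge0 x0 (mulr_ge0 (sqr_ge0 (1 - t)) (addr_ge0 y0 ler01)); nra.
rewrite (_ : _ * _ = 32 * C * v); last by rewrite /r subKr; field; rewrite gt_eqF.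
rewrite ler_pdivlMr ?ltr0n// -[leLHS]mulrA (_ : 64 * C = 32 * C * 2); last by ring.
rewrite ler_wpM2l//; first by rewrite mulr_ge0// ltW.
have : k.+1%:R <= 2 * n.+1%:R :> R by rewrite -natrM ler_nat.
by move/(ler_wpM2l (ltW v0)); rewrite mulrCA vE mulr1.
Qed.

End CarlesonEstimates.

(** * The mean of the cubic kernel *)

Section PoissonTonelli.
Context {R : realType}.
Variable mu : {finite_measure set R -> \bar R}.
Implicit Types (s t rho : R).
Local Notation normc := (@Normc.normc R).
Local Notation leb := (@lebesgue_measure R).
Local Notation D := (`[0%R, 1%R[%classic : set R).
Local Notation I := (`[0%R, (2 * pi)%R]%classic : set R).

(** An upper bound for [|1 - s e^(i theta)|^-3] whose mean over [theta] is
    explicit: one factor is replaced by its minimum, the other two form the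
    Poisson kernel. *)
Definition cubic_kernel s theta : R :=
  ((1 - s) * (1 - 2 * s * cos theta + s ^+ 2))^-1.

Lemma normc_sqr_1Bcis s theta :
  normc (1 - (s%:C)%C * cis theta) ^+ 2 = 1 - 2 * s * cos theta + s ^+ 2.
Proof.
rewrite normc_sqrE /cis /= !(mul0r, subr0, add0r, addr0).
transitivity (1 - 2 * s * cos theta + s ^+ 2 * (cos theta ^+ 2 + sin theta ^+ 2)).
  by ring.
by rewrite cos2Dsin2 mulr1.
Qed.

Lemma cubic_kernel_ge0 s theta : s < 1 -> 0 <= cubic_kernel s theta.
Proof.
move=> s1; rewrite invr_ge0 -normc_sqr_1Bcis mulr_ge0 ?sqr_ge0// subr_ge0.
exact: ltW.
Qed.

Lemma measurable_cubic_kernel rho :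
  measurable_fun setT (fun p : R * R => cubic_kernel (rho * p.2) p.1).
Proof.
have m1 : measurable_fun setT (fun p : R * R => cos p.1).
  apply: (measurableT_comp (continuous_measurable_fun (@continuous_cos R))).
  exact: measurable_fst.
have m2 : measurable_fun setT (fun p : R * R => rho * p.2).
  by apply: measurable_funM => //; exact: measurable_snd.
apply: (measurableT_comp measurable_invr).
apply: measurable_funM; first by apply: measurable_funB.
apply: measurable_funD.
  apply: measurable_funB => //; apply: measurable_funM => //.
  by apply: measurable_funM.
exact: (measurableT_comp (exprn_measurable _)).
Qed.

Lemma circle_integral_cubic_kernel s : 0 <= s < 1 ->
  (\int[leb]_(theta in I) (cubic_kernel s theta)%:E =
   (2 * pi / ((1 - s) * (1 - s ^+ 2)))%:E)%E.
Proof.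
move=> s01; have /andP[s0 s1] := s01.
have cp : continuous (fun theta => (normc (1 - (s%:C)%C * cis theta) ^+ 2)^-1).
  move=> theta; apply: cvgV.
    rewrite sqrf_eq0; apply: contraTneq isT => /Normc.eq0_normc/eqP.
    rewrite subr_eq0 => /eqP h; have := normc_circle theta s0.
    by rewrite -h normc1 => e; move: s1; rewrite -e ltxx.
  have cn : (fun x => normc (1 - (s%:C)%C * cis x)) @ theta -->
      normc (1 - (s%:C)%C * cis theta).
    have cw : (fun x => 1 - (s%:C)%C * cis x) @ theta -->
        (1 - (s%:C)%C * cis theta : cplx R).
      have cs : (fun x => (s%:C)%C * cis x) @ theta --> ((s%:C)%C * cis theta : cplx R).
        by apply: cvgMr; exact: continuous_cis.
      have c1 : (fun x : R => 1 : cplx R) @ theta --> (1 : cplx R) by exact: cvg_cst.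
      exact: cvgB c1 cs.
    exact: (@cvg_normc _ _ (nbhs theta) _ _ _ cw).
  exact: (cvg_comp _ _ cn (@exprn_continuous R 2 _)).
have ip := circle_integrable cp.
transitivity ((1 - s)^-1%:E * \int[leb]_(theta in I)
    ((normc (1 - (s%:C)%C * cis theta) ^+ 2)^-1)%:E)%E.
  rewrite -integralZl//; apply: eq_integral => theta _.
  by rewrite -EFinM /cubic_kernel -normc_sqr_1Bcis invfM.
have := circle_integral_poisson s01; rewrite /Rintegral => H.
rewrite -[X in (_ * X)%E]fineK; last exact: integrable_fin_num ip.
by rewrite H -EFinM invfM mulrCA mulrA.
Qed.

(** Exchanging the two integrals by Tonelli's theorem, the mean over [theta] is
    the explicit one above, and [1 - s ^ 2 >= 1 - s] leaves the Carleson integral. *)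
Lemma integral_cubic_kernel_le rho : 0 <= rho < 1 ->
  measurable_fun I (fun theta =>
    \int[mu]_(t in D) (cubic_kernel (rho * t) theta)%:E)%E /\
  (\int[leb]_(theta in I) \int[mu]_(t in D) (cubic_kernel (rho * t) theta)%:E
   <= (2 * pi * \int[mu]_(t in D) ((1 - rho * t) ^+ 2)^-1)%:E)%E.
Proof.
move=> r01; have /andP[r0 r1] := r01.
pose f (p : R * R) : \bar R :=
  (\1_I p.1 * \1_D p.2 * cubic_kernel (rho * p.2) p.1)%:E.
have mf : measurable_fun setT f.
  apply/measurable_EFinP; apply: measurable_funM; last exact: measurable_cubic_kernel.
  by apply: measurable_funM; apply: (measurableT_comp (measurable_indic _)).
have rt1 t : 0 <= t < 1 -> 0 <= rho * t < 1.
  by move=> /andP[t0 t1]; apply/andP; split; nra.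
have f0 p : (0 <= f p)%E.
  rewrite lee_fin !indicE; have [/set_mem/= pD|] := boolP (p.2 \in D).
    move: pD; rewrite in_itv/= => /rt1/andP[_ r2].
    by rewrite mulr_ge0 ?cubic_kernel_ge0// mulr_ge0.
  by rewrite mulr0 mul0r.
pose G theta := (\int[mu]_(t in D) (cubic_kernel (rho * t) theta)%:E)%E.
pose H t := (\int[leb]_(theta in I) (cubic_kernel (rho * t) theta)%:E)%E.
have EG : (fun theta => \int[mu]_t f (theta, t))%E = G \_ I.
  apply/funext => theta; rewrite /patch /f /=; case: ifPn => thI.
    rewrite /G [RHS]integral_mkcond; apply: eq_integral => t _.
    rewrite /patch !indicE thI mul1r; case: ifPn => tD; last by rewrite mul0r.
    by rewrite mul1r.
  apply: integral0_eq => t _; by rewrite indicE (negbTE thI) !mul0r.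
have EH : (fun t => \int[leb]_theta f (theta, t))%E = H \_ D.
  apply/funext => t; rewrite /patch /f /=; case: ifPn => tD.
    rewrite /H [RHS]integral_mkcond; apply: eq_integral => theta _.
    rewrite /patch !indicE tD mulr1; case: ifPn => thI; last by rewrite mul0r.
    by rewrite mul1r.
  apply: integral0_eq => theta _; by rewrite !indicE (negbTE tD) mulr0 mul0r.
split.
  apply/(measurable_restrictT _ _).2 => //; rewrite -EG.
  exact: (measurable_fun_fubini_tonelli_F f mf f0).
have T := fubini_tonelli (m1 := leb) (m2 := mu) f mf f0.
have -> : (\int[leb]_(theta in I) G theta = \int[mu]_(t in D) H t)%E.
  by rewrite [LHS]integral_mkcond -EG T EH -integral_mkcond.
have ik := kernel_sqr_integrable mu r01.
have i2 : mu.-integrable D (EFin \o (fun t => 2 * pi * ((1 - rho * t) ^+ 2)^-1)).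
  exact: (integrableZl (measurable_itv _) (2 * pi) ik).
rewrite -RintegralZl// fineK; last exact: integrable_fin_num i2.
apply: ge0_le_integral => //.
- move=> t /=; rewrite in_itv/= => /rt1/andP[_ r2].
  by apply: integral_ge0 => theta _; rewrite lee_fin cubic_kernel_ge0.
- apply/(measurable_restrictT _ _).2 => //; rewrite -EH.
  by have := measurable_fun_fubini_tonelli_G (m1 := leb) f mf f0.
- exact: measurable_int i2.
move=> t /=; rewrite in_itv/= => /[dup] /andP[t0 t1] /rt1 rt.
rewrite /H circle_integral_cubic_kernel// lee_fin ler_wpM2l//.
  by rewrite mulr_ge0 ?pi_ge0.
have /andP[rt0 rt1'] := rt.
rewrite lef_pV2 ?posrE; last 2 first.
- by rewrite mulr_gt0 ?subr_gt0// exprn_ilt1.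
- by rewrite exprn_gt0// subr_gt0.
by rewrite expr2 ler_wpM2l ?subr_ge0 ?(ltW rt1')// lerD2l lerN2 expr2 ler_piMr// ltW.
Qed.

End PoissonTonelli.

(** * The second derivative of the transform *)

Section SecondDerivativeBound.
Context {R : realType}.
Variable mu : {finite_measure set R -> \bar R}.
Implicit Types (z w : cplx R) (t rho : R).
Local Notation normc := (@Normc.normc R).
Local Notation leb := (@lebesgue_measure R).
Local Notation D := (`[0%R, 1%R[%classic : set R).
Local Notation I := (`[0%R, (2 * pi)%R]%classic : set R).

(** The partial sums of [2 t ^ 2 / (1 - t z) ^ 3], with [z] on the circle of radius
    [rho]: the truncation error is uniform in [t] and tends to [0], and one of the
    three factors [|1 - t z|] is replaced by its lower bound [1 - rho * t]. *)
Lemma sum_second_diff_cubic_kernel rho : 0 <= rho < 1 ->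
  exists2 E : nat -> R, E @ \oo --> (0 : R) &
    forall theta t N, 0 <= t < 1 ->
      normc (\sum_(0 <= n < N) ((n.+1 * n.+2)%:R * ((rho%:C)%C * cis theta) ^+ n)
          * ((t ^+ n.+2)%:C)%C) <= (2 + E N) * cubic_kernel (rho * t) theta.
Proof.
move=> r01; have /andP[r0 r1] := r01.
exists (fun n => 4 * ((n.+1 * n.+2)%:R * rho ^+ n)).
  rewrite -(mulr0 4); apply: cvgMr; apply: cvg_series_cvg_0.
  apply: nondecreasing_is_cvgn.
    apply: nondecreasing_series => n _ _.
    by rewrite mulr_ge0 ?exprn_ge0.
  by exists (2 / (1 - rho) ^+ 3) => _ [N _ <-]; exact: sum_second_diff_le.
move=> theta t N /andP[t0 t1].
pose w : cplx R := ((rho * t)%:C)%C * cis theta.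
have rt : 0 <= rho * t by rewrite mulr_ge0.
have rt' : rho * t <= rho by rewrite ler_piMr// ltW.
have wr : normc w <= rho by rewrite normc_circle.
have -> : \sum_(0 <= n < N) ((n.+1 * n.+2)%:R * ((rho%:C)%C * cis theta) ^+ n)
    * ((t ^+ n.+2)%:C)%C =
    ((t ^+ 2)%:C)%C * \sum_(0 <= n < N) (n.+1 * n.+2)%:R * w ^+ n.
  rewrite mulr_sumr; apply: eq_bigr => n _.
  rewrite /w !exprMn -!rmorphXn -[n.+2]addn2 exprD exprMn !rmorphM/=; ring.
set S := \sum_(0 <= n < N) _.
have d1 : 0 < 1 - rho * t by lra.
have d2 : 1 - rho * t <= normc (1 - w).
  have := ler_dist_normc 1 w; rewrite normc1 /w normc_circle//.
have d0 : 0 < normc (1 - w) by exact: lt_le_trans d2.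
apply: (@le_trans _ _ (normc S)).
  rewrite normcM ler_piMl ?normc_ge0// normc_real ger0_norm ?exprn_ge0//.
  by rewrite exprn_ile1// ltW.
apply: (@le_trans _ _ ((2 + 4 * ((N.+1 * N.+2)%:R * rho ^+ N)) / normc (1 - w) ^+ 3)).
  rewrite ler_pdivlMr ?exprn_gt0// -normcX -normcM mulrC sum_second_diff.
  apply: le_trans (ler_normcB _ _) _; apply: lerD.
    by rewrite normc_nat.
  rewrite normcM normcX mulrC mulrA.
  apply: ler_pM; rewrite ?normc_ge0 ?exprn_ge0 ?normc_ge0//; last first.
    by rewrite lerXn2r ?nnegrE ?normc_ge0.
  have w1 : normc w <= 1 by lra.
  apply: le_trans (ler_normcD _ _) _.
  apply: le_trans (lerD (ler_normcB _ _) (lexx _)) _.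
  rewrite [normc (_ * w ^+ 2)]normcM normcX.
  rewrite [normc (_ * w)]normcM !normc_nat.
  apply: (@le_trans _ _ ((N.+1 * N.+2)%:R + (2 * N * N.+2)%:R + (N * N.+1)%:R)).
    rewrite lerD//.
      by rewrite lerD2l ler_piMr.
    by rewrite ler_piMr// exprn_ile1// normc_ge0.
  by rewrite -!natrD -natrM ler_nat; nia.
rewrite ler_wpM2l//.
  by rewrite addr_ge0// mulr_ge0// mulr_ge0// exprn_ge0.
rewrite /cubic_kernel -normc_sqr_1Bcis lef_pV2 ?posrE; last 2 first.
- by rewrite exprn_gt0.
- by rewrite mulr_gt0// exprn_gt0.
by rewrite [leRHS]exprS ler_wpM2r ?sqr_ge0.
Qed.

Lemma cubic_kernel_integrable rho theta : 0 <= rho < 1 ->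
  mu.-integrable D (EFin \o (fun t => cubic_kernel (rho * t) theta)).
Proof.
move=> /andP[r0 r1]; apply: (@finite_integrable _ _ _ ((1 - rho) ^+ 3)^-1).
  apply: measurable_funTS.
  apply: (measurableT_comp (@measurable_cubic_kernel R rho)
    (measurable_fun_pair (measurable_cst theta) (@measurable_id _ _ _))).
move=> t /andP[t0 t1].
have rt : 0 <= rho * t by rewrite mulr_ge0.
have rt' : rho * t <= rho by rewrite ler_piMr// ltW.
have d1 : 0 < 1 - rho by lra.
have d2 : 1 - rho <= normc (1 - ((rho * t)%:C)%C * cis theta).
  have := ler_dist_normc 1 (((rho * t)%:C)%C * cis theta).
  by rewrite normc1 normc_circle//; lra.
rewrite ger0_norm ?cubic_kernel_ge0//; last by lra.
rewrite /cubic_kernel -normc_sqr_1Bcis lef_pV2 ?posrE ?exprn_gt0//; last first.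
  by rewrite mulr_gt0 ?exprn_gt0//; lra.
rewrite exprS ler_pM ?sqr_ge0//; try lra.
by rewrite lerXn2r ?nnegrE ?normc_ge0// ltW.
Qed.

Variables (a : nat -> cplx R) (K B : R).
Hypothesis aK : forall N, \sum_(0 <= k < N) moment mu k * normc (a k) <= K.
Hypotheses (ta : disc_coef a) (aB : forall z, normc z < 1 -> normc (psum a z) <= B).

Let B0 : 0 <= B.
Proof. by apply: le_trans (normc_ge0 (psum a 0)) (aB _); rewrite normc0. Qed.

Lemma normc_hilbert_coef_le n : normc (hilbert_coef mu a n) <= B * moment mu n.
Proof.
have := normc_sum_hilbert_coef_le aK ta aB [:: n] (fun=> 1) id.
rewrite big_seq1 mul1r => /le_trans; apply.
rewrite ler_wpM2l// le_eqVlt; apply/orP; left; apply/eqP.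
apply: eq_Rintegral => t; rewrite inE/= in_itv/= => /andP[t0 _].
by rewrite big_seq1 mul1r normc_real ger0_norm ?exprn_ge0.
Qed.

Lemma disc_coef_hilbert : disc_coef (hilbert_coef mu a).
Proof.
move=> rho /andP[r0 r1]; exists (B * moment mu 0) => n.
apply: (@le_trans _ _ (normc (hilbert_coef mu a n))).
  by rewrite ler_piMr ?normc_ge0// exprn_ile1// ltW.
apply: le_trans (normc_hilbert_coef_le n) _.
by rewrite ler_wpM2l// moment_le.
Qed.

(** This is the integral representation
    [F'' z = \int 2 t ^ 2 f t / (1 - t z) ^ 3 dmu t] read as an inequality: the
    partial sums of [F''] are combinations of the coefficients of [F], to which
    the bound on such combinations applies. *)
Lemma normc_hilbert_second_le rho theta : 0 <= rho < 1 ->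
  normc (psum (dcoef (dcoef (hilbert_coef mu a))) ((rho%:C)%C * cis theta)) <=
  2 * B * \int[mu]_(t in D) cubic_kernel (rho * t) theta.
Proof.
move=> r01; have /andP[r0 r1] := r01.
have [E E0 HE] := sum_second_diff_cubic_kernel r01.
have ik := cubic_kernel_integrable theta r01.
set z : cplx R := (rho%:C)%C * cis theta.
set c := hilbert_coef mu a.
have z1 : normc z < 1 by rewrite normc_circle.
have t2 : disc_coef (dcoef (dcoef c)) by do 2 apply: disc_coef_dcoef; exact: disc_coef_hilbert.
have cL := @cvg_normc _ _ \oo _ _ _ (cvg_psum t2 z1).
have cR : (fun N => B * ((2 + E N) * \int[mu]_(t in D) cubic_kernel (rho * t) theta))
    @ \oo --> B * ((2 + 0) * \int[mu]_(t in D) cubic_kernel (rho * t) theta).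
  by apply: cvgMr; apply: cvgMl; apply: cvgD => //; exact: cvg_cst.
rewrite -[2 * B]mulrC -mulrA -[X in _ <= B * (X * _)]addr0.
refine (ler_cvg_to (cL _) cR _); apply: nearW => N.
have -> : series (fun n => dcoef (dcoef c) n * z ^+ n) N =
    \sum_(n <- index_iota 0 N) ((n.+1 * n.+2)%:R * z ^+ n) * c n.+2.
  by apply: eq_bigr => n _; rewrite /dcoef natrM; ring.
apply: le_trans (normc_sum_hilbert_coef_le aK ta aB _ _ (fun n => n.+2)) _.
rewrite ler_wpM2l// -RintegralZl//; apply: le_Rintegral => //.
- exact: normc_poly_integrable.
- exact: (integrableZl (measurable_itv _) (2 + E N) ik).
by move=> t /=; rewrite in_itv/=; exact: HE.
Qed.

Variable C : R.
Hypothesis C0 : 0 < C.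
Hypothesis muC : forall t : R, 0 <= t < 1 ->
  (mu `[t, 1%R[%classic <= (C * (1 - t))%:E)%E.

Lemma M1_hilbert_le rho : 0 <= rho < 1 ->
  (M1 rho (derive1n 2 (hilbert mu a : cplx R -> cplx R)) <=
    (16 * B * C / (1 - rho))%:E)%E.
Proof.
move=> r01; have /andP[r0 r1] := r01.
have tc := disc_coef_hilbert.
have t2 : disc_coef (dcoef (dcoef (hilbert_coef mu a))) by do 2 apply: disc_coef_dcoef.
have iF := circle_integrable (continuous_normc_comp (continuous_psum_circle t2 r01)).
rewrite (_ : hilbert mu a = psum (hilbert_coef mu a))// M1_derive1n2_psum//.
have [mG TG] := integral_cubic_kernel_le mu r01.
have p0 : 0 < 2 * pi :> R by rewrite mulr_gt0 ?pi_gt0.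
have H : \int[leb]_(t in I)
    normc (psum (dcoef (dcoef (hilbert_coef mu a))) ((rho%:C)%C * cis t)) <=
    2 * B * (2 * pi * \int[mu]_(t in D) ((1 - rho * t) ^+ 2)^-1).
  rewrite -lee_fin fineK; last exact: integrable_fin_num iF.
  apply: (@le_trans _ _ (\int[leb]_(theta in I)
     ((2 * B)%:E * \int[mu]_(t in D) (cubic_kernel (rho * t) theta)%:E))%E).
    apply: ge0_le_integral => //.
    - by move=> t _; rewrite lee_fin normc_ge0.
    - exact: measurable_int iF.
    - exact: measurable_funeM.
    move=> theta _; have ik := cubic_kernel_integrable theta r01.
    rewrite -[X in (_ * X)%E]fineK; last exact: integrable_fin_num ik.
    by rewrite -EFinM lee_fin normc_hilbert_second_le.
  rewrite ge0_integralZl_EFin ?mulr_ge0//; last first.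
    move=> theta _; apply: integral_ge0 => t /=; rewrite in_itv/= => /andP[t0 t1].
    by rewrite lee_fin cubic_kernel_ge0//; nra.
  by rewrite (EFinM (2 * B)) lee_wpmul2l// lee_fin mulr_ge0.
rewrite lee_fin mulrC ler_pdivrMr//; apply: le_trans H _.
have := carleson_kernel_le C0 muC r01.
rewrite (_ : 16 * B * C / (1 - rho) * (2 * pi) =
  2 * B * (2 * pi * (8 * C / (1 - rho)))); last ring.
by move=> h; rewrite ler_wpM2l ?mulr_ge0// ler_wpM2l// ltW.
Qed.

End SecondDerivativeBound.

(** * Sufficiency of the Carleson condition *)

Section Sufficiency.
Context {R : realType}.
Variable mu : {finite_measure set R -> \bar R}.
Implicit Types (c a : nat -> cplx R) (f : cplx R -> cplx R) (z : cplx R).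
Local Notation normc := (@Normc.normc R).

Lemma psum0 c : psum c 0 = c 0%N.
Proof.
apply: cvg_lim => //; apply: (@cvg_normc_le _ _ _ _ _ _ (fun=> 0)); last exact: cvg_cst.
exists 1%N => // -[//|N] _ /=.
rewrite /series/= big_nat_recl//= big1 => [|i _].
  by rewrite expr0 mulr1 addr0 subrr normc0.
by rewrite expr0n/= mulr0.
Qed.

Lemma power_series_disc_coef f a : power_series_on_disc f a -> disc_coef a.
Proof.
move=> fa rho /andP[r0 r1].
have z1 : normc ((rho%:C)%C : cplx R) < 1.
  by rewrite normc_real ger0_norm// ltW.
have cz : cvgn (series (fun n => a n * ((rho%:C)%C : cplx R) ^+ n)).
  by apply/cvg_ex; exists (f (rho%:C)%C); exact: fa.
have c0 := @cvg_normc _ _ \oo _ _ _ (cvg_series_cvg_0 cz).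
have : cvgn (fun n => normc (a n * ((rho%:C)%C : cplx R) ^+ n)).
  by apply/cvg_ex; eexists; exact: c0.
move=> /cvg_seq_bounded/bounded_fun_has_ubound[M v_M].
exists M => n; apply: le_trans (v_M (normc (a n * ((rho%:C)%C : cplx R) ^+ n)) _).
  by rewrite normcM normcX normc_real ger0_norm// ltW.
by exists n.
Qed.

Lemma power_series_psum f a z : power_series_on_disc f a -> normc z < 1 ->
  psum a z = f z.
Proof. by move=> fa z1; apply: cvg_lim => //; exact: fa. Qed.

Lemma Hinf_norm_fin f : in_Hinf f -> exists2 B : R, Hinf_norm f = B%:E &
  forall z, normc z < 1 -> normc (f z) <= B.
Proof.
move=> [_ foo].
have ub z : normc z < 1 -> ((normc (f z))%:E <= Hinf_norm f)%E.
  by move=> z1; apply: ereal_sup_ubound; exists z.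
have f0 : (0 <= Hinf_norm f)%E.
  apply: le_trans (ub 0 _); first by rewrite lee_fin normc_ge0.
  by rewrite normc0.
exists (fine (Hinf_norm f)); first by rewrite fineK// ge0_fin_numE.
by move=> z /ub; rewrite -{1}(@fineK _ (Hinf_norm f)) ?ge0_fin_numE// lee_fin.
Qed.

(** The factor [1 - r ^ 2] in the norm cancels the growth [1 / (1 - r)] of the means
    of the second derivative. *)
Lemma carleson_bounded : carleson mu -> hilbert_bounded_Hinf_zygmund mu.
Proof.
move=> [C C0 muC]; exists (2 * moment mu 0 + 32 * C) => f a fH fa.
have [B fB fle] := Hinf_norm_fin fH.
have ta := power_series_disc_coef fa.
have aB z : normc z < 1 -> normc (psum a z) <= B.
  by move=> z1; rewrite (power_series_psum fa)// fle.
have B0 : 0 <= B by apply: le_trans (normc_ge0 _) (fle 0 _); rewrite normc0.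
have [K aK] := sum_moment_coef_le ta aB (carleson_moment_le C0 muC).
have tc := disc_coef_hilbert aK ta aB.
have le_coef := normc_hilbert_coef_le aK ta aB.
have aF : analytic_on_disc (hilbert mu a) by exact: analytic_psum tc.
have le_norm : (zygmund_norm (hilbert mu a) <=
    (2 * moment mu 0 + 32 * C)%:E * Hinf_norm f)%E.
  rewrite fB -EFinM (_ : _ * B = B * moment mu 0 + B * moment mu 0 + 32 * B * C);
    last ring.
  rewrite !EFinD /zygmund_norm; apply: leeD; first apply: leeD.
  - by rewrite lee_fin [hilbert mu a 0]psum0.
  - rewrite lee_fin [derive1 _ _](derive1_psum tc) ?normc0//.
    rewrite psum0 /dcoef mul1r; apply: le_trans (le_coef 1%N) _.
    by rewrite ler_wpM2l// moment_le.
  apply: ge_ereal_sup => _ [r /= + <-]; rewrite in_itv/= => /andP[r0 r1].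
  have r01 : 0 <= r < 1 by rewrite ltW.
  have rr : 0 <= 1 - r ^+ 2 by rewrite subr_ge0 exprn_ile1// ltW.
  apply: le_trans (lee_wpmul2l _ (M1_hilbert_le aK ta aB C0 muC r01)) _.
    by rewrite lee_fin.
  rewrite -EFinM lee_fin.
  rewrite (_ : (1 - r ^+ 2) * _ = 16 * B * C * (1 + r)); last first.
    by field; rewrite subr_eq0 gt_eqF.
  have := mulr_ge0 B0 (ltW C0); nra.
split; [split|split|exact: le_norm].
- by move=> n; apply/cvg_ex; exists (hilbert_coef mu a n); exact: cvg_hilbert_coef aK n.
- by move=> z z1; apply/cvg_ex; exists (hilbert mu a z); exact: cvg_psum tc z1.
- exact: aF.
- exact: aF.
- by apply: le_lt_trans le_norm _; rewrite fB -EFinM ltry.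
Qed.

End Sufficiency.

(** * Necessity of the Carleson condition *)

Section Necessity.
Context {R : realType}.
Variable mu : {finite_measure set R -> \bar R}.
Implicit Types (z : cplx R) (t r : R).
Local Notation normc := (@Normc.normc R).
Local Notation D := (`[0%R, 1%R[%classic : set R).

Local Notation cone := (@cst (cplx R) (cplx R) 1%R).

Definition coef_one (n : nat) : cplx R := (n == 0%N)%:R.

Lemma power_series_one : power_series_on_disc cone coef_one.
Proof.
move=> z _; apply: (@cvg_normc_le _ _ _ _ _ _ (fun=> 0)); last exact: cvg_cst.
exists 1%N => // -[//|N] _ /=.
rewrite /series/= big_nat_recl//= big1 => [|i _]; last by rewrite mul0r.
by rewrite /coef_one expr0 mulr1 addr0 subrr normc0.
Qed.

Lemma in_Hinf_one : in_Hinf cone /\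
  (Hinf_norm cone <= 1)%E.
Proof.
have le1 : (Hinf_norm cone <= 1)%E.
  by apply: ge_ereal_sup => _ [z _ <-]; rewrite lee_fin [normc _]normc1.
split=> //; split; last by apply: le_lt_trans le1 _; rewrite ltry.
by move=> z _; exact: derivable_cst.
Qed.

Lemma hilbert_coef_one n : hilbert_coef mu coef_one n = ((moment mu n)%:C)%C.
Proof.
apply: cvg_lim => //; apply: (@cvg_normc_le _ _ _ _ _ _ (fun=> 0)); last exact: cvg_cst.
exists 1%N => // -[//|N] _ /=.
rewrite /hilbert_coef_series /series/= big_nat_recl//= big1 => [|i _].
  by rewrite /coef_one mulr1 !addr0 addn0 subrr normc0.
by rewrite mulr0.
Qed.

Lemma disc_coef_moment : disc_coef (fun n => ((moment mu n)%:C)%C : cplx R).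
Proof.
move=> rho /andP[r0 r1]; exists (moment mu 0) => n.
rewrite normc_real ger0_norm ?moment_ge0//.
apply: le_trans (moment_le mu (leq0n n)).
by rewrite ler_piMr ?moment_ge0// exprn_ile1// ltW.
Qed.

(** Markov's inequality for the function [x ^+ n], increasing on [[0, 1[]. *)
Lemma measure_tail_le_moment t n : 0 <= t < 1 ->
  t ^+ n * fine (mu `[t, 1%R[%classic) <= moment mu n.
Proof.
move=> /andP[t0 t1]; have im := moment_integrable mu n.
have mfin : mu `[t, 1%R[%classic \is a fin_num by exact: fin_num_measure.
rewrite -lee_fin fineK; last exact: integrable_fin_num im.
rewrite EFinM fineK//.
have -> : mu `[t, 1%R[%classic = (\int[mu]_(x in D) (\1_(`[t, 1%R[%classic) x)%:E)%E.
  rewrite integral_indic//; congr (mu _); rewrite setIidl// => x /=.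
  by rewrite !in_itv/= => /andP[tx ->]; rewrite (le_trans t0).
have m1 : measurable_fun D (fun x => (\1_(`[t, 1%R[%classic) x)%:E : \bar R).
  by apply/measurable_EFinP; apply: measurable_indic.
rewrite -ge0_integralZl_EFin ?exprn_ge0//.
apply: ge0_le_integral => //.
- by move=> x _; rewrite mule_ge0// lee_fin exprn_ge0.
- exact: measurable_funeM.
- exact: measurable_int im.
move=> x /=; rewrite in_itv/= => /andP[x0 x1]; rewrite -EFinM lee_fin indicE.
have [/set_mem/=|_] := boolP (x \in _); last by rewrite mulr0 exprn_ge0.
by rewrite in_itv/= => /andP[tx _]; rewrite mulr1 lerXn2r.
Qed.

(** The only test function needed is the constant [1]: its transform has the
    moments as coefficients, and a single Fourier coefficient of the second
    derivative already sees the Carleson condition. *)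
Lemma bounded_moment_le : hilbert_bounded_Hinf_zygmund mu ->
  exists2 K : R, 0 <= K & forall n r, 0 < r < 1 ->
    (1 - r ^+ 2) * ((n.+1 * n.+2)%:R * moment mu n.+2 * r ^+ n) <= K.
Proof.
move=> [C HC]; have [f1 fle] := in_Hinf_one.
have [_ _ leC] := HC _ _ f1 power_series_one.
exists `|C| => // n r /andP[r0 r1].
have tm := disc_coef_moment.
have r01 : 0 <= r < 1 by rewrite ltW.
have rr : 0 <= 1 - r ^+ 2 by rewrite subr_ge0 exprn_ile1// ltW.
have Fm : hilbert mu coef_one = psum (fun n => ((moment mu n)%:C)%C).
  have -> : (fun n => ((moment mu n)%:C)%C) = hilbert_coef mu coef_one.
    by apply/funext => k; rewrite hilbert_coef_one.
  by [].
set F := (hilbert mu coef_one : cplx R -> cplx R) in leC *.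
have M1C : ((1 - r ^+ 2)%:E * M1 r (derive1n 2 F) <= `|C|%:E)%E.
  apply: (@le_trans _ _ (zygmund_norm F)).
    apply: (@le_trans _ _ (ereal_sup
        [set (1 - s ^+ 2)%:E * M1 s (derive1n 2 F) | s in `]0%R, 1%R[])%E).
      by apply: ereal_sup_ubound; exists r => //=; rewrite in_itv/= r0.
    by rewrite /zygmund_norm leeDr// adde_ge0// lee_fin normc_ge0.
  apply: le_trans leC _; apply: (@le_trans _ _ (`|C|%:E * Hinf_norm cone)%E).
    apply: lee_wpmul2r; last by rewrite lee_fin ler_norm.
    apply: (@le_trans _ _ (normc (cone (0 : cplx R)))%:E).
      by rewrite lee_fin normc_ge0.
    by apply: ereal_sup_ubound; exists 0 => //; rewrite /unit_disc /mkset normc0.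
  by rewrite -[leRHS]mule1; apply: lee_wpmul2l; rewrite ?lee_fin.
move: M1C; rewrite /F Fm M1_derive1n2_psum// -EFinM lee_fin; apply: le_trans.
rewrite ler_wpM2l// ler_pdivlMl ?mulr_gt0 ?pi_gt0//.
have t2 := disc_coef_dcoef (disc_coef_dcoef tm).
apply: le_trans (cauchy_estimate n t2 r01).
rewrite le_eqVlt; apply/orP; left; apply/eqP; congr (_ * (_ * _)).
by rewrite /dcoef !normcM !normc_nat normc_real ger0_norm ?moment_ge0// natrM mulrA.
Qed.

(** Away from [1] the Carleson condition is just finiteness. Near [1], the index [n]
    is taken of order [1 / (1 - t)] and the radius is [t] itself: then [t ^+ n] is
    bounded below, and the estimate on the moments bounds the tail at [t]. *)
Lemma bounded_carleson : hilbert_bounded_Hinf_zygmund mu -> carleson mu.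
Proof.
move=> /bounded_moment_le[K K0 HK].
pose m0 := moment mu 0.
have m00 : 0 <= m0 := moment_ge0 mu 0.
exists (64 * K + 2 * m0 + 1) => [|t t01]; first by lra.
have /andP[t0 t1] := t01.
have mfin : mu `[t, 1%R[%classic \is a fin_num by exact: fin_num_measure.
rewrite -(fineK mfin) lee_fin.
have tail n := measure_tail_le_moment n t01.
set m := fine _ in tail *.
have mge0 : 0 <= m by rewrite fine_ge0.
have [th|th] := ltP t (2^-1).
  have := tail 0%N; rewrite expr0 mul1r -/m0 => mm0; nra.
(* With [n] the integer part of [x], [n * (1 - t) <= 1 / 2 <= (n + 1) * (1 - t)]. *)
pose x := (2 * (1 - t))^-1.
have d0 : 0 < 2 * (1 - t) by lra.
have x0 : 0 < x by rewrite invr_gt0.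
have xd : x * (2 * (1 - t)) = 1 by rewrite mulVf// gt_eqF.
have /andP[nx xn] := truncn_itv (ltW x0).
set n := Num.truncn x in nx xn.
have tn : 2^-1 <= t ^+ n.
  have t01' : 0 <= t <= 1 by rewrite t0 ltW.
  by apply: le_trans (bernoulli_le n t01'); nra.
have t0' : 0 < t < 1 by rewrite t1 andbT; lra.
have H := HK n t t0'; have T := tail n.+2.
have mMp : m / 16 <= moment mu n.+2 * t ^+ n.
  apply: (@le_trans _ _ (t ^+ n.+2 * m * t ^+ n)); last first.
    by rewrite ler_wpM2r// exprn_ge0.
  have t2 : 4^-1 <= t ^+ 2 by rewrite expr2; nra.
  have q : 8^-1 <= t ^+ n.+2.
    by rewrite -[n.+2]addn2 exprD; move: (t ^+ n) (t ^+ 2) tn t2 => u v; nra.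
  by rewrite mulrAC [m / 16]mulrC ler_wpM2r//; move: (t ^+ n.+2) (t ^+ n) q tn => u v; nra.
have xx : x * x <= (n.+1 * n.+2)%:R.
  have n2 : n.+1%:R <= n.+2%:R :> R by rewrite ler_nat.
  by rewrite natrM ler_pM ?(ltW x0)//; lra.
have lo : (1 - t) * (x * x * (m / 16)) <= K.
  apply: le_trans H; rewrite -[_ * moment mu _ * _]mulrA.
  have m16 : 0 <= m / 16 by rewrite divr_ge0.
  apply: ler_pM; [lra| |by rewrite expr2; nra|].
    by rewrite mulr_ge0// mulr_ge0// ltW.
  by apply: ler_pM => //; rewrite mulr_ge0// ltW.
have mK : m <= 64 * K * (1 - t).
  have -> : m = 64 * ((1 - t) * (x * x * (m / 16))) * (1 - t).
    transitivity ((x * (2 * (1 - t))) ^+ 2 * m); last by field.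
    by rewrite xd expr1n mul1r.
  by rewrite ler_wpM2r ?ler_wpM2l//; lra.
by nra.
Qed.

End Necessity.

Theorem theorem1p1 (R : realType) (mu : {finite_measure set R -> \bar R})
  (mu_supp : mu (~` `[0%R, 1%R[%classic) = 0%E) :
  hilbert_bounded_Hinf_zygmund mu <-> carleson mu.
Proof. by split; [exact: bounded_carleson|exact: carleson_bounded]. Qed.
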